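(* Let $\sigma>0$, $k\ge0$, $L\ge2$. Define $g:[0,\infty)^L\to[0,\infty)^L$ by $$g(x)=(g_i(x))_{i=1}^L,\qquad g_i(x)=\frac{e^{-2\sigma E_{i+1}(x)}-e^{-2\sigma E_i(x)}}{2\sigma},$$ where $E_i(x)=\sum_{\ell=i}^Lx_\ell$ for $1\le i\le L$ and $E_{L+1}(x)=0$. Let $X(t)=(X_i(t))_{i=1}^L$ be the ABEP$(\sigma,k)$ process on $\{1,\dots,L\}$ with closed boundary conditions started from $X(0)=x\in[0,\infty)^L$. Then the process $Z(t)=(Z_i(t))_{i=1}^L$ defined by $Z(t):=g(X(t))$ is the BEP$(k)$ process on $\{1,\dots,L\}$ with closed boundary conditions and initial condition $Z(0)=g(x)$.
   Context: ABEP$(\sigma,k)$ with closed boundary conditions is the Markov diffusion process on $[0,\infty)^L$ whose generator acts on the core of smooth functions as $\sum_{i=1}^{L-1}\mathcal L^{ABEP}_{i,i+1}$, $$\mathcal L^{ABEP}_{i,i+1}f(x)=\tfrac1{4\sigma^2}(1-e^{-2\sigma x_i})(e^{2\sigma x_{i+1}}-1)\Big(\tfrac{\partial}{\partial x_i}-\tfrac{\partial}{\partial x_{i+1}}\Big)^2f(x)-\tfrac1{2\sigma}\Big\{(1-e^{-2\sigma x_i})(e^{2\sigma x_{i+1}}-1)+2k\big(2-e^{-2\sigma x_i}-e^{2\sigma x_{i+1}}\big)\Big\}\Big(\tfrac{\partial}{\partial x_i}-\tfrac{\partial}{\partial x_{i+1}}\Big)f(x).$$ BEP$(k)$ with closed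 boundary conditions is the Markov diffusion process on $[0,\infty)^L$ with generator $\sum_{i=1}^{L-1}\mathcal L^{BEP}_{i,i+1}$, $$\mathcal L^{BEP}_{i,i+1}=z_iz_{i+1}\Big(\tfrac{\partial}{\partial z_i}-\tfrac{\partial}{\partial z_{i+1}}\Big)^2-2k(z_i-z_{i+1})\Big(\tfrac{\partial}{\partial z_i}-\tfrac{\partial}{\partial z_{i+1}}\Big).$$ *)

(* Defs.v *)
From HB Require Import structures.
From mathcomp Require Export all_boot all_order all_algebra.
From mathcomp Require Export all_classical all_reals all_analysis.

Set Implicit Arguments.
Unset Strict Implicit.
Unset Printing Implicit Defensive.

Export Order.TTheory GRing.Theory Num.Theory.
Export numFieldNormedType.Exports.

Local Open Scope classical_set_scope.
Local Open Scope ring_scope.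

(* Functions on the state space [0, oo)^L are represented by functions on R^L
   that are only ever inspected on [orthant]. *)
Definition orthant (R : realType) (L : nat) : set 'rV[R]_L :=
  [set x | forall i, 0 <= x ord0 i].

(* The space C_0([0, oo)^L). *)
Definition C0 (R : realType) (L : nat) (f : 'rV[R]_L -> R) : Prop :=
  {within @orthant R L, continuous f} /\
  (forall e : R, 0 < e -> exists M : R,
     forall x, orthant x -> M < `|x| -> `|f x| < e).

Definition partial (R : realType) (L : nat) (i : 'I_L) (f : 'rV[R]_L -> R) :
  'rV[R]_L -> R := fun x => 'D_(delta_mx ord0 i) f x.

(* C^oo on R^L: all iterated partial derivatives exist and are Frechet
   differentiable (hence continuous). *)
Definition smooth (R : realType) (L : nat) (f : 'rV[R]_L -> R) : Prop :=
  forall (s : seq 'I_L) (x : 'rV[R]_L),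
    differentiable (foldr (@partial R L) f s) x.

(* Representatives of C_c^oo([0, oo)^L), the restrictions to the orthant of
   smooth functions; the support is compact in the closed orthant and may meet
   its boundary. *)
Definition test_function (R : realType) (L : nat) (f : 'rV[R]_L -> R) : Prop :=
  smooth f /\
  exists M : R, forall x, orthant x -> M < `|x| -> f x = 0.

(* Conservative Feller semigroups (T_t)_{t >= 0} on C_0([0, oo)^L); T t is
   unconstrained for t < 0. *)
Record feller_semigroup (R : realType) (L : nat)
    (T : R -> ('rV[R]_L -> R) -> 'rV[R]_L -> R) : Prop := FellerSemigroup {
  feller_C0 : forall (t : R) (f : 'rV[R]_L -> R),
    0 <= t -> C0 f -> C0 (T t f) ;
  feller_linear : forall (t a : R) (f h : 'rV[R]_L -> R) (x : 'rV[R]_L),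
    0 <= t -> C0 f -> C0 h -> orthant x ->
    T t (fun y => a * f y + h y) x = a * T t f x + T t h x ;
  feller_contraction : forall (t : R) (f : 'rV[R]_L -> R),
    0 <= t -> C0 f ->
    (forall x, orthant x -> 0 <= f x <= 1) ->
    forall x, orthant x -> 0 <= T t f x <= 1 ;
  feller_conservative : forall (t : R) (x : 'rV[R]_L) (e : R),
    0 <= t -> orthant x -> 0 < e ->
    exists f : 'rV[R]_L -> R, [/\ C0 f, (forall y, orthant y -> 0 <= f y <= 1) &
                  1 - e < T t f x] ;
  feller_0 : forall f x, C0 f -> orthant x -> T 0 f x = f x ;
  feller_D : forall (s t : R) (f : 'rV[R]_L -> R) (x : 'rV[R]_L),
    0 <= s -> 0 <= t -> C0 f -> orthant x ->
    T (s + t) f x = T s (T t f) x ;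
  feller_strong_continuity : forall (f : 'rV[R]_L -> R) (e : R),
    C0 f -> 0 < e ->
    \forall t \near 0^'+, forall x, orthant x -> `|T t f x - f x| <= e
}.

(* f is in the domain of the infinitesimal generator A of T, and A f = h: the
   limit of (T_t f - f) / t as t decreases to 0 is h, in the sup norm. *)
Definition in_generator (R : realType) (L : nat)
    (T : R -> ('rV[R]_L -> R) -> 'rV[R]_L -> R)
    (f h : 'rV[R]_L -> R) : Prop :=
  [/\ C0 f, C0 h &
   forall e : R, 0 < e -> \forall t \near 0^'+,
     forall x, orthant x -> `|(T t f x - f x) / t - h x| <= e].

(* The test functions form a core of the generator of T (the generator is the
   closure of its restriction to them), on which it acts as [A]. *)
Definition generator_acts_on_core (R : realType) (L : nat)
    (T : R -> ('rV[R]_L -> R) -> 'rV[R]_L -> R)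
    (A : ('rV[R]_L -> R) -> 'rV[R]_L -> R) : Prop :=
  (forall f, test_function f -> in_generator T f (A f)) /\
  (forall f h, in_generator T f h -> forall e : R, 0 < e ->
     exists p, [/\ test_function p,
       (forall x, orthant x -> `|p x - f x| <= e) &
       (forall x, orthant x -> `|A p x - h x| <= e)]).

(* The sigma-algebra sigma(X_u, 0 <= u <= s), coordinatewise. *)
Definition natural_filtration (R : realType) (L : nat) (d : measure_display)
    (Omega : measurableType d) (X : R -> Omega -> 'rV[R]_L) (s : R) :
    set (set Omega) :=
  <<s [set C | exists (u : R) (i : 'I_L) (B : set R),
         [/\ 0 <= u <= s, measurable B &
             C = (fun w => X u w ord0 i) @^-1` B]] >>.

(* The Markov property E[f(X_{s+t}) | F_s] = T_t f (X_s), with the conditional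
   expectation spelled out through integrals over the events of F_s. *)
Definition markov_property (R : realType) (L : nat) (d : measure_display)
    (Omega : measurableType d) (P : probability Omega R)
    (T : R -> ('rV[R]_L -> R) -> 'rV[R]_L -> R)
    (X : R -> Omega -> 'rV[R]_L) : Prop :=
  forall (s t : R) (f : 'rV[R]_L -> R) (C : set Omega),
    0 <= s -> 0 <= t -> C0 f -> natural_filtration X s C ->
    (\int[P]_(w in C) (f (X (s + t)%R w))%:E =
     \int[P]_(w in C) (T t f (X s w))%:E)%E.

(* X is, under P, the Markov diffusion process on [0, oo)^L with X(0) = x whose
   generator acts as A on the core of smooth functions. *)
Definition is_diffusion_process (R : realType) (L : nat) (d : measure_display)
    (Omega : measurableType d) (P : probability Omega R)
    (A : ('rV[R]_L -> R) -> 'rV[R]_L -> R)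
    (X : R -> Omega -> 'rV[R]_L) (x : 'rV[R]_L) : Prop :=
  [/\ (forall (t : R) (i : 'I_L), 0 <= t ->
         measurable_fun setT (fun w => X t w ord0 i)),
      (forall (t : R) (w : Omega), 0 <= t -> orthant (X t w)),
      {ae P, forall w, {within [set t : R | 0 <= t], continuous (X ^~ w)}},
      {ae P, forall w, X 0 w = x} &
      exists T : R -> ('rV[R]_L -> R) -> 'rV[R]_L -> R,
        [/\ feller_semigroup T, generator_acts_on_core T A &
            markov_property P T X]].

(* d/dx_i - d/dx_j *)
Definition bond_diff (R : realType) (L : nat) (i j : 'I_L)
    (f : 'rV[R]_L -> R) : 'rV[R]_L -> R :=
  fun x => partial i f x - partial j f x.

Definition abep_bond (R : realType) (L : nat) (sigma k : R) (i j : 'I_L)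
    (f : 'rV[R]_L -> R) (x : 'rV[R]_L) : R :=
  let a := (1 - expR (- 2 * sigma * x ord0 i)) *
           (expR (2 * sigma * x ord0 j) - 1) in
  (4 * sigma ^+ 2)^-1 * a * bond_diff i j (bond_diff i j f) x
  - (2 * sigma)^-1 *
    (a + 2 * k * (2 - expR (- 2 * sigma * x ord0 i)
                    - expR (2 * sigma * x ord0 j))) * bond_diff i j f x.

Definition bep_bond (R : realType) (L : nat) (k : R) (i j : 'I_L)
    (f : 'rV[R]_L -> R) (z : 'rV[R]_L) : R :=
  z ord0 i * z ord0 j * bond_diff i j (bond_diff i j f) z
  - 2 * k * (z ord0 i - z ord0 j) * bond_diff i j f z.

(* Closed boundary conditions: the sum runs over the bonds (i, i+1) only. *)
Definition closed_generator (R : realType) (L : nat)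
    (bond : 'I_L -> 'I_L -> ('rV[R]_L -> R) -> 'rV[R]_L -> R)
    (f : 'rV[R]_L -> R) (x : 'rV[R]_L) : R :=
  \sum_(i < L) \sum_(j < L | j == i.+1 :> nat) bond i j f x.

Definition abep_generator (R : realType) (L : nat) (sigma k : R) :=
  closed_generator (@abep_bond R L sigma k).

Definition bep_generator (R : realType) (L : nat) (k : R) :=
  closed_generator (@bep_bond R L k).

Definition is_ABEP (R : realType) (L : nat) (sigma k : R)
    (d : measure_display) (Omega : measurableType d) (P : probability Omega R)
    (X : R -> Omega -> 'rV[R]_L) (x : 'rV[R]_L) : Prop :=
  is_diffusion_process P (@abep_generator R L sigma k) X x.

Definition is_BEP (R : realType) (L : nat) (k : R)
    (d : measure_display) (Omega : measurableType d) (P : probability Omega R)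
    (Z : R -> Omega -> 'rV[R]_L) (z : 'rV[R]_L) : Prop :=
  is_diffusion_process P (@bep_generator R L k) Z z.

(* Sites are numbered from 0, so [energy m] is E_{m+1}; the sum is empty, i.e.
   E_{L+1} = 0, at m = L. *)
Definition energy (R : realType) (L : nat) (m : nat) (x : 'rV[R]_L) : R :=
  \sum_(l < L | (m <= l)%N) x ord0 l.

Definition gmap (R : realType) (L : nat) (sigma : R) (x : 'rV[R]_L) :
    'rV[R]_L :=
  \row_(i < L) ((expR (- 2 * sigma * energy i.+1 x)
                 - expR (- 2 * sigma * energy i x)) / (2 * sigma)).

(* Main.v *)
Require Import Defs.
From HB Require Import structures.
From mathcomp Require Import measurable_realfun ring lra.

Local Open Scope classical_set_scope.
Local Open Scope ring_scope.

Set Implicit Arguments.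
Unset Strict Implicit.
Unset Printing Implicit Defensive.

(** The map [gmap sigma] intertwines the two generators, but it only reaches the states of total
    energy less than [1 / (2 sigma)], so the semigroup of the BEP on the whole orthant has to be
    recovered from that of the ABEP.  In the coordinates [energy m], which [gmap] transforms one
    by one, both dynamics conserve [energy 0], and the BEP generator is invariant under dilations.
    The BEP semigroup at [z] is therefore defined by dilating [z] into the image of [gmap] and
    applying the ABEP semigroup there.  That the result does not depend on the dilation, and that
    the energy is conserved at the level of semigroups, follow from one principle: a bounded
    operator which maps the core into the domain and commutes with the generator on the core
    commutes with the semigroup.  Test functions of the ABEP extend to test functions of the BEP
    through a smooth truncation of the inverse of [gmap], which yields the core property.  Finally
    [f o gmap] need not vanish at infinity, so the Markov property is first applied to
    [f o gmap] cut off at high energy. *)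

(** * Iterated derivatives *)

(** No BEP semigroup is given beforehand, while the conclusion asks for one that is Feller on the
    whole orthant and has the test functions as a core; this is why intertwining the generators does
    not suffice. That intertwining is one-dimensional: for a bond (i, i+1) the field d/dx_i -
    d/dx_(i+1) moves only [energy i.+1], on which it acts as minus a derivative, so replacing every
    energy e by h(e) multiplies the field by h'(e). The choice h = lam W with W(e) = (1 - exp(-2
    sigma e)) / (2 sigma) works for every lam > 0, and lam = 1 gives [gmap]. Read in ABEP
    coordinates, the dilation by r < 1 sends each energy e to W^-1(r W(e)), which stays bounded, so
    composition with it does not preserve C_0. Hence the operators to be commuted have the form f ->
    w (f o theta), with a weight w that is a bump in the conserved energy. On the boundary of the
    orthant a function is known from one side only. There, generators are compared through the
    uniqueness of the semigroup derivative and through conservation of energy, not by computing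
    partial derivatives. *)

Section iterated_derivatives.
Context {R : realType} {V : normedModType R} {I : Type} (e : I -> V).

(** Bounding the order by n makes the product and chain rules provable by induction, since a
    derivative has one order less. The family of directions [e] is abstract so that the same rules
    serve functions of one variable and of row vectors. *)
Fixpoint diffn (n : nat) (f : V -> R) : Prop :=
  (forall x, differentiable f x) /\
  if n is m.+1 then forall i, diffn m (fun x => 'D_(e i) f x) else True.

Lemma diffnS n f : diffn n.+1 f <->
  (forall x, differentiable f x) /\ forall i, diffn n (fun x => 'D_(e i) f x).
Proof. by []. Qed.

Lemma diffn_differentiable n f x : diffn n f -> differentiable f x.
Proof. by case: n => [|n] []. Qed.

Lemma diffnW n f : diffn n.+1 f -> diffn n f.
Proof.
elim: n f => [|n IHn] f [df Df]; first by split.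
by split=> // i; apply: IHn; apply: Df.
Qed.

Lemma diffn_ext n f g : diffn n g -> f =1 g -> diffn n f.
Proof. by move=> Hg /funext ->. Qed.

Lemma diffn_cst n c : diffn n (fun=> c).
Proof.
elim: n c => [|n IHn] c; split=> //.
by move=> i; apply: (diffn_ext (IHn 0)) => x; exact: derive_cst.
Qed.

Lemma diffnD n f g : diffn n f -> diffn n g -> diffn n (fun x => f x + g x).
Proof.
elim: n f g => [|n IHn] f g [df Df] [dg Dg]; split=> //.
- by move=> x; apply: (@differentiableD _ _ _ f g).
- by move=> x; apply: (@differentiableD _ _ _ f g).
- move=> i; apply: (diffn_ext (IHn _ _ (Df i) (Dg i))) => x.
  by apply: (@deriveD _ _ _ f g); exact: diff_derivable.
Qed.

Lemma diffnM n f g : diffn n f -> diffn n g -> diffn n (fun x => f x * g x).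
Proof.
elim: n f g => [|n IHn] f g Hf Hg.
  by case: Hf Hg => df _ [dg _]; split=> // x; apply: (@differentiableM _ _ f g).
move/diffnS: (Hf) => [df Df]; move/diffnS: (Hg) => [dg Dg]; apply/diffnS; split; first by move=> x; apply: (@differentiableM _ _ f g).
move=> i; apply: (@diffn_ext _ _ (fun x => f x * 'D_(e i) g x + g x * 'D_(e i) f x)).
  by apply: diffnD; apply: IHn => //; [exact: diffnW Hf|exact: diffnW Hg].
by move=> x; apply: (@deriveM _ _ f g); exact: diff_derivable.
Qed.

Lemma diffnN n f : diffn n f -> diffn n (fun x => - f x).
Proof.
move=> Hf; apply: (diffn_ext (diffnM (diffn_cst n (-1)) Hf)) => x.
by rewrite mulN1r.
Qed.

Lemma diffnB n f g : diffn n f -> diffn n g -> diffn n (fun x => f x - g x).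
Proof. by move=> Hf Hg; apply: diffnD => //; exact: diffnN. Qed.

Lemma diffn_sum n k (f : 'I_k -> V -> R) :
  (forall i, diffn n (f i)) -> diffn n (fun x => \sum_(i < k) f i x).
Proof.
move=> Hf; elim: k f Hf => [|k IHk] f Hf.
  by apply: (diffn_ext (diffn_cst n 0)) => x; rewrite big_ord0.
have Hl := IHk (fun i => f (lift ord0 i)) (fun i => Hf _).
by apply: (diffn_ext (diffnD (Hf ord0) Hl)) => x; rewrite big_ord_recl.
Qed.

Lemma diffn_inv n f : (forall x, f x != 0) -> diffn n f ->
  diffn n (fun x => (f x)^-1).
Proof.
move=> f0; elim: n => [|n IHn] Hf.
  by case: Hf => df _; split=> // x; apply: (@differentiableV _ _ f).
move/diffnS: (Hf) => [df Df]; apply/diffnS; split; first by move=> x; apply: (@differentiableV _ _ f).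
move=> i; apply: (@diffn_ext _ _ (fun x => - ((f x)^-1 * (f x)^-1 * 'D_(e i) f x))).
  by apply/diffnN/diffnM => //; apply: diffnM; exact/IHn/(diffnW Hf).
move=> x; rewrite (deriveV (f0 x)); last exact: diff_derivable.
by rewrite -exprVn expr2 /GRing.scale /= mulNr.
Qed.

End iterated_derivatives.

Section composition.
Context {R : realType} {V : normedModType R} {I : Type} (e : I -> V).

Lemma derive_comp1 (h : R -> R) (f : V -> R) x v :
  differentiable f x -> differentiable h (f x) ->
  'D_v (fun x => h (f x)) x = 'D_1 h (f x) * 'D_v f x.
Proof.
move=> df dh; rewrite (_ : (fun x => _) = h \o f) //.
rewrite deriveE; last exact: differentiable_comp.
rewrite diff_comp //= deriveE // (deriveE _ df) mulrC.
by rewrite -{1}[('d f x) v]mulr1 -[_ * 1]/(_ *: 1) linearZ.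
Qed.

Lemma diffn_comp1 n (h : R -> R) (f : V -> R) :
  diffn (fun _ : unit => 1 : R) n h -> diffn e n f -> diffn e n (fun x => h (f x)).
Proof.
elim: n h f => [|n IHn] h f Hh Hf.
  by case: Hh Hf => dh _ [df _]; split=> // x; exact: (@differentiable_comp _ _ _ _ f h).
move/diffnS: (Hh) => [dh Dh]; move/diffnS: (Hf) => [df Df]; apply/diffnS; split.
  by move=> x; exact: (@differentiable_comp _ _ _ _ f h).
move=> i; apply: (@diffn_ext _ _ _ _ _ _ (fun x => 'D_1 h (f x) * 'D_(e i) f x)).
  by apply: diffnM => //; apply: (IHn (fun y => 'D_1 h y)); [exact: (Dh tt)|exact: diffnW Hf].
by move=> x; rewrite derive_comp1.
Qed.

End composition.

(** * A smooth step function *)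

Section one_variable.
Context {R : realType}.
Implicit Types (n : nat) (f : R -> R) (x y : R).

Notation diffn1 := (diffn (fun _ : unit => 1 : R)).

Lemma diffn1_is_derive n (f f' : R -> R) :
  (forall x, is_derive x 1 f (f' x)) -> diffn1 n f' -> diffn1 n.+1 f.
Proof.
move=> df Hf'; apply/diffnS; split.
  by move=> x; apply/derivable1_diffP; case: (df x).
by move=> i; apply: (diffn_ext Hf') => x; exact: derive_val.
Qed.

Lemma diffn1_id n : diffn1 n id.
Proof.
by case: n => [//|n]; apply: (diffn1_is_derive (f' := fun=> 1)); exact: diffn_cst.
Qed.

Lemma diffn1_expR n : diffn1 n (@expR R).
Proof.
elim: n => [|n IHn]; last exact: diffn1_is_derive IHn.
by split=> // x; apply/derivable1_diffP; exact: derivable_expR.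
Qed.

Lemma diffn1_ln n f : (forall x, 0 < f x) -> diffn1 n f ->
  diffn1 n (fun x => ln (f x)).
Proof.
move=> f0 Hf.
have dl x : differentiable (fun x => ln (f x)) x.
  apply: (@differentiable_comp _ _ _ _ f (@ln R)); first exact: diffn_differentiable Hf.
  by apply/derivable1_diffP; case: (is_derive1_ln (f0 x)).
case: n Hf => [|n] Hf; first by split.
apply/diffnS; split=> // i.
have f0' x : f x != 0 by rewrite gt_eqF.
move/diffnS: (Hf) => [df Df].
apply: (diffn_ext (diffnM (diffn_inv f0' (diffnW Hf)) (Df tt))) => x.
rewrite (@derive_comp1 _ _ (@ln R) f) //; last by apply/derivable1_diffP; case: (is_derive1_ln (f0 x)).
by congr (_ * _); have ? := is_derive1_ln (f0 x); exact: derive_val.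
Qed.

(** The powers of 1/x make the family closed under differentiation, so that smoothness of exp(-1/x)
    is an induction on the order. *)
Definition flat n x : R := if 0 < x then x^-1 ^+ n * expR (- x^-1) else 0.

Lemma flat_ge0 n x : 0 <= flat n x.
Proof.
by rewrite /flat; case: ifP => // x0; rewrite mulr_ge0 ?expR_ge0 ?exprn_ge0 ?invr_ge0 ?ltW.
Qed.

(** The exponential series at y = 1/x gives exp(y) >= y^(n+1) / (n+1)!. The bound is linear in x,
    which is what the derivative at 0 requires. *)
Lemma flat_le n x : flat n x <= n.+1`!%:R * `|x|.
Proof.
rewrite /flat; case: ifPn => [x0|_]; last by rewrite mulr_ge0.
have y0 : 0 <= x^-1 by rewrite invr_ge0 ltW.
have H : x^-1 ^+ n.+1 / n.+1`!%:R <= expR x^-1.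
  by apply: le_trans (expR_ge1Dxn n y0); rewrite lerDr.
have F0 : 0 < n.+1`!%:R :> R by rewrite ltr0n fact_gt0.
rewrite expRN ler_pdivrMr ?expR_gt0 // gtr0_norm //.
rewrite ler_pdivrMr // exprS in H.
rewrite -[leLHS](mulVKf (lt0r_neq0 x0)) (le_trans (ler_wpM2l (ltW x0) H)) //.
by rewrite [leRHS](_ : _ = x * (expR x^-1 * n.+1`!%:R)) //; ring.
Qed.

Lemma is_derive_of_cvg (f : R -> R) x l :
  (fun t : R => t^-1 * (f (t + x) - f x)) @ 0^' --> l -> is_derive x 1 f l.
Proof.
move=> H.
have H' : (fun h => h^-1 *: ((f \o shift x) (h *: 1) - f x)) @ 0^' --> l.
  by apply: cvg_trans H; apply: near_eq_cvg; near=> h; rewrite /= [_ *: 1]mulr1.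
by apply: DeriveDef; [apply/cvg_ex; exists l|exact: (cvg_lim _ H')].
Unshelve. all: by end_near. Qed.

Lemma is_derive_flat n x :
  is_derive x 1 (flat n) (- n%:R * flat n.+1 x + flat n.+2 x).
Proof.
have [x0|x0|->] := ltgtP x 0.
- rewrite /flat !ltNge (ltW x0) /= mulr0 addr0.
  apply: (@near_eq_is_derive _ _ _ (fun=> 0)) => //.
  near=> y; rewrite ifF //; apply/negbTE; rewrite -leNgt.
  by near: y; exact: (cvgr_le x).
- have xn0 : x != 0 by rewrite gt_eqF.
  apply: (@near_eq_is_derive _ _ _ (fun y => y^-1 ^+ n * expR (- y^-1))).
    near=> y; rewrite /flat ifT //.
    by near: y; exact: (cvgr_gt x).
  have dV : is_derive x 1 (fun y : R => y^-1) (- x ^- 2).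
    by apply: is_derive_eq (is_deriveV xn0 (is_derive_id x 1)) _; rewrite /GRing.scale /= mulr1.
  have dX : is_derive x 1 (fun y : R => y^-1 ^+ n) ((n%:R * x^-1 ^+ n.-1) *: - x ^- 2).
    have -> : (fun y : R => y^-1 ^+ n) = (fun y : R => y^-1) ^+ n.
      by apply/funext => y; rewrite exprfctE.
    exact: is_deriveX.
  have dN : is_derive x 1 (fun y : R => - y^-1) (- - x ^- 2) := is_deriveN dV.
  have dE := @is_derive1_comp R (@expR R) (fun y => - y^-1) x _ _ (is_derive_expR _) dN.
  apply: is_derive_eq (is_deriveM dX dE) _.
  rewrite /flat x0 /GRing.scale /= -!exprVn.
  case: n {dX} => [|n]; first by rewrite /= !expr0 mulr0n oppr0 !mul0r; ring.
  by rewrite /= !exprS; ring.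
- have -> : - n%:R * flat n.+1 0 + flat n.+2 0 = 0 by rewrite /flat ltxx mulr0 addr0.
  apply: is_derive_of_cvg; apply/cvgr0Pnorm_le => e e0.
  have F0 : 0 < n.+2`!%:R :> R by rewrite ltr0n fact_gt0.
  near=> h.
  have h0 : h != 0 by near: h; exact: nbhs_dnbhs_neq.
  rewrite addr0 (_ : flat n 0 = 0) ?subr0; last by rewrite /flat ltxx.
  (* The difference quotient of [flat n] at 0 is [flat n.+1] for h > 0 and 0 for h < 0, and
     [flat_le] makes it tend to 0. *)
  apply: (@le_trans _ _ (flat n.+1 h)).
    rewrite /flat; case: ifPn => [hp|_]; last by rewrite mulr0 normr0.
    by rewrite mulrA -exprS ger0_norm // mulr_ge0 ?expR_ge0 ?exprn_ge0 ?invr_ge0 ?ltW.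
  apply: (le_trans (flat_le _ _)); rewrite mulrC -ler_pdivlMr //.
  near: h; apply: dnbhs0_le; exact: divr_gt0.
Unshelve. all: by end_near. Qed.

Lemma diffn1_flat k n : diffn1 k (flat n).
Proof.
elim: k n => [|k IHk] n.
  by split=> // x; apply/derivable1_diffP; case: (is_derive_flat n x).
apply: (diffn1_is_derive (is_derive_flat n)).
by apply: diffnD => //; apply: diffnM => //; exact: diffn_cst.
Qed.

Lemma flat_eq0 n x : x <= 0 -> flat n x = 0.
Proof. by rewrite /flat ltNge => ->. Qed.

Lemma flat0_le x y : x <= y -> flat 0 x <= flat 0 y.
Proof.
move=> xy; rewrite /flat !expr0 !mul1r; case: ifPn => x0; last by case: ifP; rewrite ?expR_ge0.
by rewrite (lt_le_trans x0 xy) ler_expR lerN2 lef_pV2 // posrE (lt_le_trans x0 xy).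
Qed.

Lemma flat0_gt0 x : 0 < x -> 0 < flat 0 x.
Proof. by rewrite /flat => ->; rewrite expr0 mul1r expR_gt0. Qed.

(** The usual partition-of-unity quotient, oriented downwards: 1 on the left of 0 and 0 on the right
    of 1. *)
Definition smooth_step x : R := flat 0 (1 - x) / (flat 0 x + flat 0 (1 - x)).

Lemma smooth_step_den x : 0 < flat 0 x + flat 0 (1 - x).
Proof.
have [x0|x0] := ltP 0 x.
  by rewrite ltr_pwDl ?flat_ge0 ?flat0_gt0.
by rewrite ltr_wpDl ?flat_ge0 ?flat0_gt0 //; lra.
Qed.

Lemma diffn1_smooth_step n : diffn1 n smooth_step.
Proof.
have H : diffn1 n (fun x => flat 0 (1 - x)).
  apply: diffn_comp1; first exact: diffn1_flat.
  by apply: diffnB; [exact: diffn_cst|exact: diffn1_id].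
apply: diffnM => //; apply: diffn_inv => [x|]; first by rewrite gt_eqF ?smooth_step_den.
by apply: diffnD => //; exact: diffn1_flat.
Qed.

Lemma smooth_step1 x : x <= 0 -> smooth_step x = 1.
Proof.
move=> x0; rewrite /smooth_step (flat_eq0 _ x0) add0r divff // gt_eqF ?flat0_gt0 //.
lra.
Qed.

Lemma smooth_step0 x : 1 <= x -> smooth_step x = 0.
Proof. by move=> x1; rewrite /smooth_step flat_eq0 ?mul0r //; lra. Qed.

Lemma smooth_step_ge0 x : 0 <= smooth_step x.
Proof. by rewrite divr_ge0 ?flat_ge0 // ltW ?smooth_step_den. Qed.

Lemma smooth_step_le1 x : smooth_step x <= 1.
Proof. by rewrite ler_pdivrMr ?smooth_step_den // mul1r lerDr flat_ge0. Qed.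

Lemma smooth_step_nincr x y : x <= y -> smooth_step y <= smooth_step x.
Proof.
move=> xy; rewrite ler_pdivrMr ?smooth_step_den // mulrAC ler_pdivlMr ?smooth_step_den //.
rewrite !mulrDr [X in _ <= _ + X]mulrC lerD2r.
by apply: ler_pM; rewrite ?flat_ge0 ?flat0_le //; lra.
Qed.

Lemma smooth_step_continuous : continuous smooth_step.
Proof.
by move=> x; apply/differentiable_continuous/(diffn_differentiable _ (diffn1_smooth_step 0)).
Qed.

End one_variable.

(** * Energy coordinates *)

Section row_vectors.
Context {R : realType} {L : nat}.
Implicit Types (f : 'rV[R]_L -> R) (i : 'I_L).

Lemma smoothP f : smooth f <->
  forall n, diffn (fun i : 'I_L => delta_mx ord0 i : 'rV[R]_L) n f.
Proof.
split=> [sf n|Hf s x].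
  elim: n f sf => [|n IHn] f sf; first by split=> // x; exact: (sf [::]).
  apply/diffnS; split; first by move=> x; exact: (sf [::]).
  by move=> i; apply: IHn => s x; move: (sf (rcons s i) x); rewrite foldr_rcons.
suff H n : diffn (fun i : 'I_L => delta_mx ord0 i : 'rV[R]_L) n (foldr (@partial R L) f s).
  exact: diffn_differentiable (H 0%N).
elim: s n => [|i s IHs] n /=; first exact: Hf.
by have /diffnS[_] := IHs n.+1; apply.
Qed.

Lemma smooth_differentiable f (x : 'rV[R]_L) : smooth f -> differentiable f x.
Proof. by move=> sf; exact: (sf [::] x). Qed.

Lemma derive_partial f (x v : 'rV[R]_L) : differentiable f x ->
  'D_v f x = \sum_i v ord0 i * partial i f x.
Proof.
move=> df; rewrite deriveE // {1}[v]row_sum_delta linear_sum; apply: eq_bigr => i _.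
by rewrite linearZ /partial deriveE.
Qed.

Lemma continuous_row (T : topologicalType) (Phi : T -> 'rV[R]_L) (t : T) :
  (forall i, {for t, continuous (fun y => Phi y ord0 i)}) -> {for t, continuous Phi}.
Proof.
move=> H; apply/cvgrPdist_le => e e0; near=> y.
rewrite /Num.Def.normr/= mx_normrE (bigmax_le _ (ltW e0)) //= => -[j i] _.
rewrite !mxE/= (ord1 j).
move: i {j}; near: y; apply: filter_forall => i.
by move/cvgrPdist_le : (H i) => /(_ e e0).
Unshelve. all: by end_near. Qed.

Section composition.
Context {V : normedModType R} (Phi : V -> 'rV[R]_L).

Lemma differentiable_row y :
  (forall i, differentiable (fun x => Phi x ord0 i) y) -> differentiable Phi y.
Proof.
move=> dPhi; rewrite (_ : Phi = \sum_(i < L) (fun x => Phi x ord0 i *: delta_mx ord0 i)).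
  by apply: differentiable_sum => i; exact: differentiableZl.
by apply/funext => x; rewrite {1}[Phi x]row_sum_delta fct_sumE.
Qed.

Lemma derive_row y w i : differentiable Phi y ->
  ('D_w Phi y) ord0 i = 'D_w (fun x => Phi x ord0 i) y.
Proof. by move=> dPhi; rewrite derive_mx ?mxE //; exact: diff_derivable. Qed.

Lemma derive_comp_row f y w :
  differentiable Phi y -> differentiable f (Phi y) ->
  'D_w (fun x => f (Phi x)) y =
  \sum_i 'D_w (fun x => Phi x ord0 i) y * partial i f (Phi y).
Proof.
move=> dPhi df; rewrite (_ : (fun x => _) = f \o Phi) //.
rewrite deriveE; last exact: differentiable_comp.
rewrite diff_comp //= -(deriveE _ dPhi) -(deriveE _ df) derive_partial //.
by apply: eq_bigr => i _; rewrite derive_row.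
Qed.

Lemma diffn_comp_row (I : Type) (e : I -> V) n f :
  diffn (fun i : 'I_L => delta_mx ord0 i : 'rV[R]_L) n f ->
  (forall i, diffn e n (fun x => Phi x ord0 i)) ->
  diffn e n (fun x => f (Phi x)).
Proof.
move=> + HP.
have dP y : differentiable Phi y.
  by apply: differentiable_row => i; exact: diffn_differentiable (HP i).
elim: n f HP => [|n IHn] f HP Hf.
  split=> // x; apply: (@differentiable_comp _ _ _ _ Phi f) => //.
  exact: diffn_differentiable Hf.
have /diffnS[df Df] := Hf; apply/diffnS; split.
  by move=> x; apply: (@differentiable_comp _ _ _ _ Phi f).
move=> j; pose g x := \sum_i 'D_(e j) (fun x => Phi x ord0 i) x * partial i f (Phi x).
apply: (@diffn_ext _ _ _ _ _ _ g); last by move=> x; exact: derive_comp_row.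
apply: diffn_sum => i; apply: diffnM.
  by have /diffnS[_] := HP i; apply.
by apply: IHn => [k|]; [exact: diffnW (HP k)|exact: Df].
Qed.

End composition.
End row_vectors.

Section energies.
Context {R : realType} {L : nat}.
Implicit Types (x y v : 'rV[R]_L) (m : nat) (h k : R -> R).

Lemma energy_is_linear m : linear (@energy R L m).
Proof.
move=> a x y; rewrite /energy scaler_sumr -big_split /=.
by apply: eq_bigr => l _; rewrite !mxE.
Qed.

HB.instance Definition _ m :=
  GRing.isLinear.Build R 'rV[R]_L R _ (@energy R L m) (energy_is_linear m).

Lemma energy_differentiable m x : differentiable (@energy R L m) x.
Proof.
rewrite (_ : energy m = \sum_(l < L) (fun x => if (m <= l)%N then x ord0 l else 0)).
  apply: differentiable_sum => l; case: (m <= l)%N; last exact: differentiable_cst.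
  exact: differentiable_coord.
by apply/funext => y; rewrite fct_sumE; exact: big_mkcond.
Qed.

Lemma energy_continuous m : continuous (@energy R L m).
Proof. by move=> x; exact/differentiable_continuous/energy_differentiable. Qed.

Lemma derive_energy m x v : 'D_v (energy m) x = energy m v.
Proof.
rewrite deriveE; last exact: energy_differentiable.
by rewrite diff_lin //; exact: energy_continuous.
Qed.

Lemma energy_ge m x : (L <= m)%N -> energy m x = 0.
Proof.
move=> Lm; rewrite /energy big1 // => l ml; move: (leq_trans Lm ml).
by rewrite leqNgt ltn_ord.
Qed.

Lemma energyS x (i : 'I_L) : energy i x = x ord0 i + energy i.+1 x.
Proof.
rewrite /energy (bigD1 i) //=; congr (_ + _); apply: eq_bigl => l.
by rewrite ltn_neqAle andbC eq_sym.
Qed.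

Lemma coord_energy x (i : 'I_L) : x ord0 i = energy i x - energy i.+1 x.
Proof. by rewrite energyS addrK. Qed.

(** Descending induction from the last site, matching the recursion [energyS]; all indices from L on
    form the base case. *)
Lemma energy_ind (P : nat -> Prop) :
  (forall m, (L <= m)%N -> P m) -> (forall i : 'I_L, P i.+1 -> P i) -> forall m, P m.
Proof.
move=> PL PS m; have [n] := ubnP (L - m)%N.
elim: n m => // n IHn m; rewrite ltnS => Hn.
have [Lm|mL] := leqP L m; first exact: PL.
apply: (PS (Ordinal mL)) => /=; apply: IHn.
by rewrite subnS -ltnS prednK ?subn_gt0 //; apply: leq_trans Hn _.
Qed.

(** The increments of h along the energies: in energy coordinates this applies h to each coordinate,
    provided h 0 = 0 so that the boundary value, the energy past the last site, is kept. Composing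
    such maps then amounts to composing functions of one real variable. *)
Definition tmap h x : 'rV[R]_L := \row_(i < L) (h (energy i x) - h (energy i.+1 x)).

Lemma energy_tmap h m x : h 0 = 0 -> energy m (tmap h x) = h (energy m x).
Proof.
move=> h0; move: m; apply: energy_ind => [m Lm|i IH]; first by rewrite !energy_ge.
by rewrite energyS IH mxE subrK.
Qed.

Lemma tmap_comp h k x : k 0 = 0 -> tmap h (tmap k x) = tmap (fun e => h (k e)) x.
Proof. by move=> k0; apply/rowP => i; rewrite !mxE !energy_tmap. Qed.

Lemma eq_tmap h k x : (forall m, h (energy m x) = k (energy m x)) -> tmap h x = tmap k x.
Proof. by move=> hk; apply/rowP => i; rewrite !mxE !hk. Qed.

Lemma tmap_id x : tmap id x = x.
Proof. by apply/rowP => i; rewrite mxE -coord_energy. Qed.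

Lemma orthant_energy_ge0 m x : orthant x -> 0 <= energy m x.
Proof. by move=> Ox; apply: sumr_ge0. Qed.

Lemma orthant_energy_le m x : orthant x -> energy m x <= energy 0 x.
Proof.
move=> Ox; rewrite /energy [leRHS](bigID (fun l : 'I_L => (m <= l)%N)) /=.
by rewrite lerDl sumr_ge0.
Qed.

Lemma orthant_energyS (i : 'I_L) x : orthant x -> energy i.+1 x <= energy i x.
Proof. by move=> Ox; rewrite energyS lerDr. Qed.

Lemma orthant_tmap h x : (forall a b, 0 <= a -> a <= b -> b <= energy 0 x -> h a <= h b) ->
  orthant x -> orthant (tmap h x).
Proof.
move=> hh Ox i; rewrite mxE subr_ge0; apply: hh.
- exact: orthant_energy_ge0.
- exact: orthant_energyS.
- exact: orthant_energy_le.
Qed.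

Lemma orthant_norm_le x : orthant x -> `|x| <= energy 0 x.
Proof.
move=> Ox; rewrite /Num.Def.normr/= mx_normrE; apply: bigmax_le => /=.
  exact: orthant_energy_ge0.
move=> [j i] _ /=; rewrite (ord1 j) ger0_norm //.
by rewrite -(subrK (energy i.+1 x) (x _ _)) coord_energy subrK;
   rewrite (le_trans _ (orthant_energy_le i Ox)) // lerBlDr lerDl orthant_energy_ge0.
Qed.

Lemma orthant_energy_le_norm x : orthant x -> energy 0 x <= L%:R * `|x|.
Proof.
move=> Ox; rewrite /energy /=.
apply: (@le_trans _ _ (\sum_(l < L) `|x|)).
  apply: ler_sum => l _; rewrite -[leLHS]ger0_norm // /Num.Def.normr/= mx_normrE.
  exact: (le_bigmax _ _ (ord0, l)).
by rewrite sumr_const card_ord mulr_natl.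
Qed.

Lemma tmap_continuous h x :
  (forall m, {for energy m x, continuous h}) -> {for x, continuous (tmap h)}.
Proof.
move=> ch; apply: continuous_row => i.
rewrite (_ : (fun y => _) = fun y => h (energy i y) - h (energy i.+1 y)); last first.
  by apply/funext => y; rewrite mxE.
have c m : {for x, continuous (fun y => h (energy m y))}.
  by apply: (@continuous_comp _ _ _ (energy m) h); [exact: energy_continuous|exact: ch].
exact: (cvgB (c i) (c i.+1)).
Qed.

End energies.

(** * The change of variables and the generators *)

Section smooth_energy.
Context {R : realType} {L : nat}.
Implicit Types (f : 'rV[R]_L -> R) (h : R -> R) (x : 'rV[R]_L) (m n : nat) (i j : 'I_L).

Notation diffnL := (diffn (fun i : 'I_L => delta_mx ord0 i : 'rV[R]_L)).
Notation diffn1 := (diffn (fun _ : unit => 1 : R)).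

Lemma diffn_energy n m : diffnL n (@energy R L m).
Proof.
case: n => [|n]; first by split=> // x; exact: energy_differentiable.
apply/diffnS; split; first by move=> x; exact: energy_differentiable.
by move=> i; apply: (diffn_ext (diffn_cst _ n _)) => x; exact: derive_energy.
Qed.

Lemma diffn_fun_energy n m h : diffn1 n h -> diffnL n (fun x => h (energy m x)).
Proof. by move=> Hh; apply: diffn_comp1 => //; exact: diffn_energy. Qed.

Lemma diffn_tmap n h i : diffn1 n h -> diffnL n (fun x => tmap h x ord0 i).
Proof.
move=> Hh; apply: (diffn_ext (diffnB (diffn_fun_energy i Hh) (diffn_fun_energy i.+1 Hh))).
by move=> x; rewrite mxE.
Qed.

Lemma differentiable_tmap h x : diffn1 0 h -> differentiable (@tmap R L h) x.
Proof.
move=> Hh; apply: differentiable_row => i.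
exact: diffn_differentiable (diffn_tmap i Hh).
Qed.

Lemma smooth_tmap f h : smooth f -> (forall n, diffn1 n h) -> smooth (fun x => f (tmap h x)).
Proof.
move=> /smoothP sf sh; apply/smoothP => n; apply: diffn_comp_row => // i.
exact: diffn_tmap.
Qed.

Lemma smooth_mul f g : smooth f -> smooth g -> smooth (fun x => f x * g x).
Proof. by move=> /smoothP sf /smoothP sg; apply/smoothP => n; exact: diffnM. Qed.

Lemma smooth_fun_energy m h : (forall n, diffn1 n h) -> smooth (fun x => h (@energy R L m x)).
Proof. by move=> sh; apply/smoothP => n; exact: diffn_fun_energy. Qed.

Lemma smooth_partial i f : smooth f -> smooth (partial i f).
Proof. by move=> /smoothP sf; apply/smoothP => n; have /diffnS[_] := sf n.+1; apply. Qed.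

Lemma smooth_bond_diff i j f : smooth f -> smooth (bond_diff i j f).
Proof.
move=> sf; apply/smoothP => n; have /smoothP Hi := smooth_partial i sf.
by have /smoothP Hj := smooth_partial j sf; exact: diffnB.
Qed.

Lemma energy_delta m i : energy m (delta_mx ord0 i : 'rV[R]_L) = (m <= i)%:R.
Proof.
rewrite /energy; case: leqP => mi; last first.
  by rewrite big1 // => l ml; rewrite mxE eqxx /=; case: eqP => // li;
     move: ml; rewrite li leqNgt mi.
by rewrite (bigD1 i) //= mxE !eqxx big1 ?addr0 // => l /andP[_ /negbTE li]; rewrite mxE li andbF.
Qed.

Lemma bond_diff_mul i j f g x : differentiable f x -> differentiable g x ->
  bond_diff i j (fun y => f y * g y) x = f x * bond_diff i j g x + g x * bond_diff i j f x.
Proof.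
move=> df dg; rewrite /bond_diff /partial.
have D v : 'D_v (fun y => f y * g y) x = f x * 'D_v g x + g x * 'D_v f x.
  by apply: (@deriveM _ _ f g); exact: diff_derivable.
rewrite !D; move: ('D_(delta_mx ord0 i) f x) ('D_(delta_mx ord0 j) f x)
  ('D_(delta_mx ord0 i) g x) ('D_(delta_mx ord0 j) g x) (f x) (g x) => *; ring.
Qed.

(** For j = i + 1 the bracket is -1 at m = j and 0 elsewhere; in particular functions of the total
    energy, m = 0, are annihilated. *)
Lemma bond_diff_fun_energy i j m h x : differentiable h (energy m x) ->
  bond_diff i j (fun y => h (energy m y)) x =
  'D_1 h (energy m x) * ((m <= i)%:R - (m <= j)%:R).
Proof.
move=> dh; have D v : 'D_v (fun y => h (energy m y)) x = 'D_1 h (energy m x) * energy m v.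
  by rewrite (@derive_comp1 _ _ h (energy m)) // ?derive_energy //; exact: energy_differentiable.
by rewrite /bond_diff /partial !D !energy_delta mulrBr.
Qed.

Lemma bond_diff_tmap i j f h x : j = i.+1 :> nat -> diffn1 0 h ->
  differentiable f (tmap h x) ->
  bond_diff i j (fun y => f (tmap h y)) x =
  'D_1 h (energy j x) * bond_diff i j f (tmap h x).
Proof.
move=> ji Hh df.
rewrite {1}/bond_diff /partial !derive_comp_row //; try exact: differentiable_tmap.
rewrite -sumrB.
(* The bond field moves only [energy j], which enters the components i and j of [tmap h] alone, with
   opposite signs; the sum over l therefore collapses to two terms. *)
have dc l : bond_diff i j (fun y => tmap h y ord0 l) x =
    'D_1 h (energy l.+1 x) * (l == i)%:R - 'D_1 h (energy l x) * (l == j)%:R.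
  have -> : (fun y => tmap h y ord0 l) =
            (fun y => h (energy l y) + -1 * h (energy l.+1 y)).
    by apply/funext => y; rewrite mxE mulN1r.
  have dE m y : differentiable (fun y => h (@energy R L m y)) y.
    exact: diffn_differentiable (diffn_fun_energy m Hh).
  have dh e : differentiable h e by exact: diffn_differentiable Hh.
  have -> : bond_diff i j (fun y => h (energy l y) + -1 * h (energy l.+1 y)) x =
     bond_diff i j (fun y => h (energy l y)) x - bond_diff i j (fun y => h (energy l.+1 y)) x.
    rewrite /bond_diff /partial.
    have D v : 'D_v (fun y => h (energy l y) + -1 * h (energy l.+1 y)) x =
        'D_v (fun y => h (energy l y)) x - 'D_v (fun y => h (energy l.+1 y)) x.
      rewrite (_ : (fun y => _ + _) = (fun y => h (energy l y)) - (fun y => h (energy l.+1 y))).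
        by apply: deriveB; exact: diff_derivable.
      by apply/funext => y; rewrite mulN1r.
    by rewrite !D; move: ('D_(delta_mx ord0 i) _ _) ('D_(delta_mx ord0 i) _ _)
      ('D_(delta_mx ord0 j) _ _) ('D_(delta_mx ord0 j) _ _) => *; ring.
  rewrite !bond_diff_fun_energy // ji.
  have -> : (l == i)%:R = (l <= i)%:R - (l < i)%:R :> R.
    by rewrite ltn_neqAle -val_eqE /=; case: eqP => [->|_]; rewrite ?leqnn ?subr0 ?subrr.
  have -> : (l == j)%:R = (l <= j)%:R - (l < j)%:R :> R.
    by rewrite ltn_neqAle -val_eqE /=; case: eqP => [->|_]; rewrite ?leqnn ?subr0 ?subrr.
  rewrite ji !ltnS; move: ('D_1 h (energy l x)) ('D_1 h (energy l.+1 x)) => *; ring.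
rewrite (eq_bigr (fun l => bond_diff i j (fun y => tmap h y ord0 l) x * partial l f (tmap h x)));
  last by move=> l _; rewrite /bond_diff mulrBl.
have ij : i != j by rewrite -val_eqE /= ji neq_ltn ltnSn.
rewrite (bigD1 i) //= (bigD1 j) /=; last by rewrite eq_sym.
rewrite big1 => [|l /andP[/negbTE li /negbTE lj]]; last by rewrite dc li lj !mulr0 subrr mul0r.
rewrite !dc !eqxx (negbTE ij) eq_sym (negbTE ij) -ji /bond_diff /= mulr1n mulr0n.
move: (partial i f _) (partial j f _) ('D_1 h _) => a b c; ring.
Qed.

(** The field is applied to the product h'(energy j) times the transported first derivative; the
    minus sign of h'' comes from the field being minus the derivative in [energy j]. *)
Lemma bond_diff2_tmap i j f h x : j = i.+1 :> nat -> (forall n, diffn1 n h) -> smooth f ->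
  bond_diff i j (bond_diff i j (fun y => f (tmap h y))) x =
  'D_1 h (energy j x) ^+ 2 * bond_diff i j (bond_diff i j f) (tmap h x)
  - 'D_1 (fun e => 'D_1 h e) (energy j x) * bond_diff i j f (tmap h x).
Proof.
move=> ji sh sf.
have sh' n : diffn1 n (fun e => 'D_1 h e) by have /diffnS[_ /(_ tt)] := sh n.+1.
rewrite (_ : bond_diff i j (fun y => f (tmap h y)) =
  fun y => 'D_1 h (energy j y) * bond_diff i j f (tmap h y)); last first.
  by apply/funext => y; apply: bond_diff_tmap => //; exact: smooth_differentiable.
have sb := smooth_bond_diff i j sf.
rewrite bond_diff_mul; last 2 first.
- exact: diffn_differentiable (diffn_fun_energy j (sh' 0%N)).
- exact/smooth_differentiable/smooth_tmap.
rewrite bond_diff_tmap //; last exact: smooth_differentiable.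
rewrite (@bond_diff_fun_energy i j j (fun e => 'D_1 h e)); last first.
  exact: diffn_differentiable (sh' 0%N).
rewrite leqnn ji ltnn -ji /= mulr1n mulr0n.
move: (bond_diff i j (bond_diff i j f) (tmap h x)) (bond_diff i j f (tmap h x)).
move: ('D_1 (fun e => 'D_1 h e) (energy j x)) ('D_1 h (energy j x)) => a b c d.
ring.
Qed.

Lemma bond_diff_energy0_mul i j f h x : (forall n, diffn1 n h) -> smooth f ->
  bond_diff i j (fun y => h (energy 0 y) * f y) x = h (energy 0 x) * bond_diff i j f x.
Proof.
move=> sh sf; rewrite bond_diff_mul; last 2 first.
- exact/smooth_differentiable/smooth_fun_energy.
- exact: smooth_differentiable.
rewrite bond_diff_fun_energy; last exact: diffn_differentiable (sh 0%N).
by rewrite !leq0n subrr mulr0 mulr0 addr0.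
Qed.

Lemma eq_closed_generator (bond bond' : 'I_L -> 'I_L -> ('rV[R]_L -> R) -> 'rV[R]_L -> R)
    f g x y c :
  (forall i j, j = i.+1 :> nat -> bond i j f x = c * bond' i j g y) ->
  closed_generator bond f x = c * closed_generator bond' g y.
Proof.
move=> H; rewrite /closed_generator mulr_sumr; apply: eq_bigr => i _.
by rewrite mulr_sumr; apply: eq_bigr => j /eqP; exact: H.
Qed.

End smooth_energy.

Section generators.
Context {R : realType} {L : nat} (sigma k : R) (sigma_gt0 : 0 < sigma).
Implicit Types (f : 'rV[R]_L -> R) (x : 'rV[R]_L) (lam e w : R).

Notation diffn1 := (diffn (fun _ : unit => 1 : R)).
Local Notation ABEP := (@abep_generator R L sigma k).
Local Notation BEP := (@bep_generator R L k).

Lemma abep_generator_energy0_mul f h x : (forall n, diffn1 n h) -> smooth f ->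
  ABEP (fun y => h (energy 0 y) * f y) x = h (energy 0 x) * ABEP f x.
Proof.
move=> sh sf; apply: eq_closed_generator => i j _; rewrite /abep_bond.
rewrite (_ : bond_diff i j (fun y => h (energy 0 y) * f y) =
  fun y => h (energy 0 y) * bond_diff i j f y); last first.
  by apply/funext => y; exact: bond_diff_energy0_mul.
rewrite bond_diff_energy0_mul //; last exact: smooth_bond_diff.
move: (bond_diff i j (bond_diff i j f) x) (bond_diff i j f x) (h (energy 0 x)) => a b c; ring.
Qed.

Definition Wfun e : R := (1 - expR (- 2 * sigma * e)) / (2 * sigma).

Lemma gmapE x : gmap sigma x = tmap Wfun x.
Proof. by apply/rowP => i; rewrite !mxE /Wfun -mulrBl; congr (_ / _); ring. Qed.

Lemma is_derive_scaleW lam e : is_derive e 1 (fun e => lam * Wfun e) (lam * expR (- 2 * sigma * e)).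
Proof.
have d1 : is_derive e 1 (fun e => - 2 * sigma * e) (- 2 * sigma).
  by apply: is_derive_eq (is_deriveZ (- 2 * sigma) (is_derive_id e 1)) _; rewrite /GRing.scale /= mulr1.
have d2 := @is_derive1_comp R (@expR R) _ e _ _ (is_derive_expR _) d1.
have -> : (fun e => lam * Wfun e) =
    (lam / (2 * sigma)) *: (cst 1 - (expR \o (fun e => - 2 * sigma * e))).
  apply/funext => y; rewrite -[RHS]/(lam / (2 * sigma) * (1 - expR (- 2 * sigma * y))) /Wfun.
  by move: (expR _) => a; ring.
have d3 : is_derive e 1 (cst (1 : R)) 0 by exact: is_derive_cst.
have d4 := is_deriveZ (lam / (2 * sigma)) (is_deriveB d3 d2).
apply: is_derive_eq d4 _.
by rewrite /GRing.scale /=; field; rewrite gt_eqF.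
Qed.

Lemma diffn1_scaleW n lam : diffn1 n (fun e => lam * Wfun e).
Proof.
apply: diffnM; first exact: diffn_cst.
apply: diffnM; last exact: diffn_cst.
apply: diffnB; first exact: diffn_cst.
apply: diffn_comp1; first exact: diffn1_expR.
by apply: diffnM; [exact: diffn_cst|exact: diffn1_id].
Qed.

(** Here h = lam W satisfies h'' = -2 sigma h', so the second-order term also produces the drift
    correction of the ABEP. The scale lam drops out because the BEP bond operators are homogeneous
    of degree 0. *)
Lemma abep_generator_scaleW f lam x : smooth f ->
  ABEP (fun y => f (tmap (fun e => lam * Wfun e) y)) x =
  BEP f (tmap (fun e => lam * Wfun e) x).
Proof.
move=> sf; rewrite -[RHS]mul1r; apply: eq_closed_generator => i j ji; rewrite mul1r.
have d1 : (fun e => 'D_1 (fun e => lam * Wfun e) e) = (fun e => lam * expR (- 2 * sigma * e)).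
  by apply/funext => e; have ? := is_derive_scaleW lam e; exact: derive_val.
have d2 e : 'D_1 (fun e => lam * expR (- 2 * sigma * e)) e = - 2 * sigma * (lam * expR (- 2 * sigma * e)).
  have de : is_derive e 1 (fun e => - 2 * sigma * e) (- 2 * sigma).
    by apply: is_derive_eq (is_deriveZ (- 2 * sigma) (is_derive_id e 1)) _; rewrite /GRing.scale /= mulr1.
  have := is_deriveZ lam (@is_derive1_comp R (@expR R) _ e _ _ (is_derive_expR _) de).
  by move=> H; rewrite (@derive_val _ _ _ _ _ _ _ H) /GRing.scale /=; ring.
have sh n : diffn1 n (fun e => lam * Wfun e) := diffn1_scaleW n lam.
rewrite /abep_bond /bep_bond (bond_diff2_tmap x ji sh sf).
rewrite (bond_diff_tmap ji (sh 0%N)); last exact: smooth_differentiable.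
have -> : 'D_1 (fun e => lam * Wfun e) (energy j x) = lam * expR (- 2 * sigma * energy j x).
  exact: (congr1 (fun F => F (energy j x)) d1).
rewrite d1 d2 !mxE -ji /Wfun (energyS x i) -ji.
set E := energy j x; set B2 := bond_diff i j (bond_diff i j f) _; set B := bond_diff i j f _.
(* All exponentials are expressed through those of [energy j], x_i and x_j, which turns the claim
   into an identity of rational functions. *)
have -> : expR (- 2 * sigma * (x ord0 i + E)) =
    expR (- 2 * sigma * x ord0 i) * expR (- 2 * sigma * E) by rewrite mulrDr expRD.
have -> : expR (- 2 * sigma * energy j.+1 x) =
    expR (2 * sigma * x ord0 j) * expR (- 2 * sigma * E).
  by rewrite -expRD; congr expR; rewrite /E (energyS x j); ring.
move: B2 B (expR (- 2 * sigma * E)) (expR (- 2 * sigma * x ord0 i))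
  (expR (2 * sigma * x ord0 j)) => B2 B a b c.
by field; rewrite gt_eqF.
Qed.

End generators.

(** * Functions vanishing at infinity *)

Section right_neighbourhoods.
Context {R : realType}.

Lemma near_right0P (P : R -> Prop) :
  (\forall t \near 0^'+, P t) <-> exists2 d : R, 0 < d & forall t, 0 < t -> t < d -> P t.
Proof.
split=> [|[d d0 H]].
  move=> [d /= d0 H]; exists d => // t t0 td; apply: H => //=.
  by rewrite sub0r normrN gtr0_norm.
near=> t; apply: H; near: t; [exact: nbhs_right_gt|exact: nbhs_right_lt].
Unshelve. all: by end_near. Qed.

End right_neighbourhoods.

Section vanishing_functions.
Context {R : realType} {L : nat}.
Implicit Types (f g h : 'rV[R]_L -> R) (x y : 'rV[R]_L).

Local Notation O := (@orthant R L).

Definition bounded_by (C : R) f := forall x, O x -> `|f x| <= C.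

Lemma within_orthantP f : {within O, continuous f} <->
  forall x, O x -> forall e : R, 0 < e -> \forall y \near x, O y -> `|f x - f y| <= e.
Proof.
split=> [/subspace_continuousP H x Ox e e0|H].
  by move/cvgrPdist_le : (H x Ox) => /(_ e e0).
apply/subspace_continuousP => x Ox; apply/cvgrPdist_le => e e0.
by rewrite near_withinE; exact: H.
Qed.

Lemma within_orthant_comp f (Phi : 'rV[R]_L -> 'rV[R]_L) :
  {within O, continuous f} -> (forall x, O x -> {for x, continuous Phi}) ->
  (forall x, O x -> O (Phi x)) -> {within O, continuous (fun x => f (Phi x))}.
Proof.
move=> /within_orthantP cf cP OP; apply/within_orthantP => x Ox e e0.
have H := cf _ (OP _ Ox) e e0.
have K : \forall y \near x, O (Phi y) -> `|f (Phi x) - f (Phi y)| <= e.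
  exact: (cP x Ox _ H).
by move: K; apply: filterS => y /= K Oy; apply: K; exact: OP.
Qed.

Lemma within_orthant_ext f g : {within O, continuous f} -> (forall x, O x -> f x = g x) ->
  {within O, continuous g}.
Proof.
by move=> cf fg; apply: subspace_eq_continuous cf => x; rewrite inE => /fg.
Qed.

Lemma within_orthantM f g : {within O, continuous f} -> {within O, continuous g} ->
  {within O, continuous (fun x => f x * g x)}.
Proof.
move=> /subspace_continuousP cf /subspace_continuousP cg.
by apply/subspace_continuousP => x Ox; apply: cvgM; [exact: cf|exact: cg].
Qed.

Lemma within_orthantD f g : {within O, continuous f} -> {within O, continuous g} ->
  {within O, continuous (fun x => f x + g x)}.
Proof.
move=> /subspace_continuousP cf /subspace_continuousP cg.
by apply/subspace_continuousP => x Ox; apply: cvgD; [exact: cf|exact: cg].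
Qed.

Lemma within_orthant_fun_energy m (rho : R -> R) :
  continuous rho -> {within O, continuous (fun x => rho (energy m x))}.
Proof.
move=> cr; apply: continuous_subspaceT => x.
by apply: (@continuous_comp _ _ _ (energy m) rho); [exact: energy_continuous|exact: cr].
Qed.

Lemma C0_ext f g : C0 f -> (forall x, O x -> f x = g x) -> C0 g.
Proof.
move=> [cf f0] fg; split; first exact: within_orthant_ext fg.
by move=> e /f0[M H]; exists M => x Ox Mx; rewrite -fg //; exact: H.
Qed.

Lemma C0_bounded f : C0 f -> exists2 B : R, 0 < B & bounded_by B f.
Proof.
move=> [cf f0]; have [M HM] := f0 1 ltr01.
(* M may be negative; the maximum with 0 keeps the box nonempty, as the extreme value theorem
   requires. *)
pose K : set 'rV[R]_L := [set v | forall i, `[0, Num.max 0 M]%classic (v ord0 i)].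
have cK : compact K by apply: (@rV_compact R L (fun=> `[0, Num.max 0 M]%classic)) => _; exact: segment_compact.
have KO : K `<=` O by move=> x Kx i; have /andP[] := Kx i.
have K0 : K !=set0.
  exists 0 => i; rewrite /= mxE in_itv /= lexx /=; by rewrite le_max lexx.
have cfK : {within K, continuous (fun x => `|f x|)}.
  apply: (continuous_subspaceW KO); move/within_orthantP : cf => cf.
  apply/within_orthantP => x Ox e e0; move: (cf x Ox e e0); apply: filterS => y H Oy.
  exact: le_trans (ler_dist_dist _ _) (H Oy).
have [c _ Hc] := EVT_max_rV K0 cK cfK.
exists (Num.max 1 `|f c|); first by rewrite lt_max ltr01.
move=> x Ox; rewrite le_max; have [xM|Mx] := leP `|x| M; last by rewrite ltW // HM.
rewrite Hc ?orbT // inE => i; rewrite /= in_itv /= Ox /= le_max; apply/orP; right.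
apply: le_trans xM; rewrite -[leLHS]ger0_norm // /Num.Def.normr/= mx_normrE.
exact: (le_bigmax _ _ (ord0, i)).
Qed.

Lemma C0_lincomb (a : R) f g : C0 f -> C0 g -> C0 (fun x => a * f x + g x).
Proof.
move=> [cf f0] [cg g0]; split.
  apply: within_orthantD => //; apply: within_orthantM => //.
  by apply: continuous_subspaceT => x; exact: cst_continuous.
move=> e e0; have A0 : 0 < `|a| + 1 by rewrite ltr_pwDr.
have [M1 H1] := f0 (e / (2 * (`|a| + 1))) (divr_gt0 e0 (mulr_gt0 (ltr0Sn _ _) A0)).
have [M2 H2] := g0 (e / 2) (divr_gt0 e0 (ltr0Sn _ _)).
exists (Num.max M1 M2) => x Ox; rewrite gt_max => /andP[/(H1 x Ox) K1 /(H2 x Ox) K2].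
apply: (le_lt_trans (ler_normD _ _)); rewrite [ltRHS]splitr ler_ltD //.
rewrite normrM; apply: (@le_trans _ _ ((`|a| + 1) * (e / (2 * (`|a| + 1))))).
  by apply: ler_pM => //; [rewrite lerDl|exact: ltW].
by rewrite le_eqVlt; apply/orP; left; apply/eqP; field; rewrite gt_eqF.
Qed.

Lemma C0_sub f g : C0 f -> C0 g -> C0 (fun x => f x - g x).
Proof. by move=> cf cg; apply: C0_ext (C0_lincomb (-1) cg cf) _ => x _; rewrite mulN1r addrC. Qed.

Lemma C0_cst0 : C0 (fun=> 0 : R) (L := L).
Proof.
split; first by apply: continuous_subspaceT => x; exact: cst_continuous.
by move=> e e0; exists 0 => x _ _; rewrite normr0.
Qed.

Lemma C0_scale (a : R) f : C0 f -> C0 (fun x => a * f x).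
Proof. by move=> cf; apply: C0_ext (C0_lincomb a cf C0_cst0) _ => x _; rewrite addr0. Qed.

Lemma C0_dominated f g : C0 f -> {within O, continuous g} ->
  (exists C, forall x, O x -> `|g x| <= C * `|f x|) -> C0 g.
Proof.
move=> [_ f0] cg [C H]; split=> // e e0.
have C1 : 0 < `|C| + 1 by rewrite ltr_pwDr.
have [M HM] := f0 (e / (`|C| + 1)) (divr_gt0 e0 C1).
exists M => x Ox Mx; apply: (le_lt_trans (H x Ox)).
apply: (@le_lt_trans _ _ ((`|C| + 1) * `|f x|)).
  by apply: ler_wpM2r => //; rewrite (le_trans (ler_norm C)) // lerDl.
by rewrite mulrC -ltr_pdivlMr // HM.
Qed.

Lemma C0_mul f g B : C0 f -> {within O, continuous g} -> bounded_by B g ->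
  C0 (fun x => g x * f x).
Proof.
move=> cf cg Bg; apply: (C0_dominated cf); first by apply: within_orthantM => //; case: cf.
by exists B => x Ox; rewrite normrM ler_wpM2r // Bg.
Qed.

Lemma C0_compact_support f K : {within O, continuous f} ->
  (forall x, O x -> K <= energy 0 x -> f x = 0) -> C0 f.
Proof.
move=> cf f0; split=> // e e0; exists K => x Ox Kx.
rewrite f0 ?normr0 //; apply: (le_trans (ltW Kx)); exact: orthant_norm_le.
Qed.

(** Decay is re-expressed in the conserved quantity; on the orthant the total energy is at most L
    times the norm. *)
Lemma C0_small f e : C0 f -> 0 < e -> exists M, forall x, O x -> M <= energy 0 x -> `|f x| <= e.
Proof.
move=> [_ f0] e0; have [M H] := f0 e e0; exists (L%:R * (`|M| + 1) + 1) => x Ox Mx.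
apply/ltW/H => //; rewrite ltNge; apply/negP => xM.
have := le_trans Mx (orthant_energy_le_norm Ox); rewrite leNgt => /negP; apply.
apply: (@le_lt_trans _ _ (L%:R * (`|M| + 1))); last by rewrite ltrDl.
by rewrite ler_wpM2l // (le_trans xM) // (le_trans (ler_norm M)) // lerDl.
Qed.

Lemma C0_uniform_limit f :
  (forall e : R, 0 < e -> exists2 g, C0 g & forall x, O x -> `|g x - f x| <= e) -> C0 f.
Proof.
move=> H; split.
  apply/within_orthantP => x Ox e e0.
  have [g [/within_orthantP cg _] gf] := H (e / 4) (divr_gt0 e0 (ltr0Sn _ _)).
  move: (cg x Ox (e / 2) (divr_gt0 e0 (ltr0Sn _ _))); apply: filterS => y K Oy.
  have := gf x Ox; have := gf y Oy; have := K Oy.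
  rewrite !ler_norml => /andP[? ?] /andP[? ?] /andP[? ?]; apply/andP; split; lra.
move=> e e0; have [g [_ g0] gf] := H (e / 2) (divr_gt0 e0 (ltr0Sn _ _)).
have [M HM] := g0 (e / 2) (divr_gt0 e0 (ltr0Sn _ _)).
exists M => x Ox Mx; have := HM x Ox Mx; have := gf x Ox.
rewrite !(ler_norml, ltr_norml) => /andP[? ?] /andP[? ?]; apply/andP; split; lra.
Qed.

End vanishing_functions.

(** * Feller semigroups *)

Section right_derivative.
Context {R : realType}.

(** Mean value inequality for one-sided derivatives: for each slope C + e, the supremum of the times
    up to which the bound holds must be t. It replaces vector-valued integration in what follows. *)
Lemma right_derivative_bound (F : R -> R) (t C : R) : 0 <= t ->
  (forall s, 0 < s -> s <= t -> forall e : R, 0 < e -> exists2 d : R, 0 < d &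
     forall u, 0 <= u -> s - d < u -> u <= s -> `|F s - F u| <= e) ->
  (forall s, 0 <= s -> s < t -> forall e : R, 0 < e -> exists2 d : R, 0 < d &
     forall r, 0 < r -> r < d -> `|F (s + r) - F s| <= (C + e) * r) ->
  `|F t - F 0| <= C * t.
Proof.
move=> t0 Fl Fr.
suff H e : 0 < e -> `|F t - F 0| <= (C + e) * t.
  apply/ler_addgt0Pr => e e0; have t1 : 0 < t + 1 by rewrite ltr_wpDl.
  apply: (le_trans (H (e / (t + 1)) (divr_gt0 e0 t1))).
  by rewrite mulrDl lerD2l mulrAC ler_pdivrMr // mulrDr mulr1 lerDl ltW.
move=> e0; pose A := [set s | [/\ 0 <= s, s <= t & `|F s - F 0| <= (C + e) * s]].
have A0 : A 0 by split => //; rewrite subrr normr0 mulr0.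
have hsA : has_sup A by split; [exists 0|exists t => s []].
have m0 : 0 <= sup A by apply: sup_upper_bound.
have mt : sup A <= t by apply: ge_sup => //; [exists 0|move=> s []].
(* Left continuity puts the supremum itself into A. *)
have Am : A (sup A).
  split=> //; move: m0; rewrite le_eqVlt => /predU1P[<-|m0].
    by rewrite subrr normr0 mulr0.
  apply/ler_addgt0Pr => e1 e10.
  have e2 : 0 < e1 / (2 * (`|C + e| + 1)) by rewrite divr_gt0 // mulr_gt0 // ltr_pwDr.
  have [d d0 Hd] := Fl _ m0 mt (e1 / 2) (divr_gt0 e10 (ltr0Sn _ _)).
  have dd0 : 0 < Num.min d (e1 / (2 * (`|C + e| + 1))) by rewrite lt_min d0.
  have [u [u0 ut Hu] mu] := sup_adherent dd0 hsA.
  have um : u <= sup A by apply: sup_upper_bound.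
  have := mu; rewrite ltrBlDr -ltrBlDl lt_min => /andP[mud mue].
  have := Hd u u0 _ um; rewrite ltrBlDr -ltrBlDl => /(_ mud) Hm.
  have K : (C + e) * u <= (C + e) * sup A + e1 / 2.
    rewrite -lerBlDl -mulrBr; apply: (le_trans (ler_norm _)); rewrite normrM distrC.
    rewrite (@ger0_norm _ (sup A - u)) ?subr_ge0 //.
    apply: (@le_trans _ _ ((`|C + e| + 1) * (e1 / (2 * (`|C + e| + 1))))).
      by apply: ler_pM => //; rewrite ?subr_ge0 // ?lerDl // ltW.
    rewrite le_eqVlt; apply/orP; left; apply/eqP; field.
    by rewrite gt_eqF // ltr_pwDr.
  rewrite -(subrKA (F u)) (le_trans (ler_normD _ _)) //; lra.
have [mt'|mt'] := ltP (sup A) t; last first.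
  have <- : sup A = t by apply/le_anti/andP.
  by case: Am.
have [d d0 Hd] := Fr _ m0 mt' e e0.
(* If the supremum were below t, the right estimate would put a larger time into A. *)
pose r := Num.min (d / 2) (t - sup A).
have r0 : 0 < r by rewrite lt_min divr_gt0 //= subr_gt0.
have rd : r < d by rewrite gt_min; apply/orP; left; lra.
have rt : r <= t - sup A by rewrite ge_min lexx orbT.
have : A (sup A + r).
  split; [by rewrite addr_ge0 // ltW|by rewrite -lerBrDl|].
  rewrite -(subrKA (F (sup A))) (le_trans (ler_normD _ _)) // mulrDr addrC lerD //.
    by case: Am.
  exact: Hd.
move=> /(sup_upper_bound hsA); rewrite gerDl leNgt r0; done.
Qed.

End right_derivative.

Section feller.
Context {R : realType} {L : nat}.
Implicit Types (f g h : 'rV[R]_L -> R) (x y : 'rV[R]_L) (s t r e a : R).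

Local Notation O := (@orthant R L).

Context (S : R -> ('rV[R]_L -> R) -> 'rV[R]_L -> R) (HS : feller_semigroup S).

(** That [S t] sees only the values on the orthant is not among the axioms. It follows from the
    contraction axiom: a function vanishing on the orthant lies in [0, 1] there, and so does its
    opposite. *)
Lemma feller_eq0 t f x : 0 <= t -> C0 f -> (forall y, O y -> f y = 0) -> O x -> S t f x = 0.
Proof.
move=> t0 cf f0 Ox.
have pos g : C0 g -> (forall y, O y -> g y = 0) -> 0 <= S t g x.
  move=> cg g0; suff /andP[] : 0 <= S t g x <= 1 by [].
  by apply: (feller_contraction HS) => // y Oy; rewrite g0 // lexx ler01.
(* The linearity axiom only covers combinations a f + h, so the opposite of f is written as -1 f +
   z, with z a zero function whose image is 0 by linearity. *)
pose z := fun y => -1 * f y + f y.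
have cz : C0 z by exact: C0_lincomb.
have z0 y : O y -> z y = 0 by move=> Oy; rewrite /z f0 // mulr0 addr0.
have Sz : S t z x = 0 by rewrite (feller_linear HS) // mulN1r addNr.
apply/eqP; rewrite eq_le pos // andbT.
have := pos (fun y => -1 * f y + z y); rewrite (feller_linear HS) // Sz addr0 mulN1r oppr_ge0.
apply; first exact: C0_lincomb.
by move=> y Oy; rewrite f0 // z0 // mulr0 addr0.
Qed.

Lemma feller_ext t f g x : 0 <= t -> C0 f -> (forall y, O y -> f y = g y) -> O x ->
  S t f x = S t g x.
Proof.
move=> t0 cf fg Ox; have cg := C0_ext cf fg.
have : S t (fun y => -1 * f y + g y) x = 0.
  apply: feller_eq0 => //; first exact: C0_lincomb.
  by move=> y Oy; rewrite fg // mulN1r addNr.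
by rewrite (feller_linear HS) // mulN1r => /eqP; rewrite addrC subr_eq0 eq_sym => /eqP.
Qed.

Lemma feller_lincomb t a f g h x : 0 <= t -> C0 f -> C0 g ->
  (forall y, O y -> h y = a * f y + g y) -> O x -> S t h x = a * S t f x + S t g x.
Proof.
move=> t0 cf cg hE Ox; rewrite -(feller_linear HS) //; apply: feller_ext => //.
by apply: C0_ext (C0_lincomb a cf cg) _ => y Oy; rewrite hE.
Qed.

Lemma feller_scale t a f h x : 0 <= t -> C0 f ->
  (forall y, O y -> h y = a * f y) -> O x -> S t h x = a * S t f x.
Proof.
move=> t0 cf hE Ox; rewrite (@feller_lincomb _ (a - 1) f f) //; first by rewrite mulrBl mul1r subrK.
by move=> y Oy; rewrite hE // mulrBl mul1r subrK.
Qed.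

Lemma feller_sub t f g h x : 0 <= t -> C0 f -> C0 g ->
  (forall y, O y -> h y = f y - g y) -> O x -> S t h x = S t f x - S t g x.
Proof.
move=> t0 cf cg hE Ox; rewrite (@feller_lincomb _ (-1) g f) //; first by rewrite mulN1r addrC.
by move=> y Oy; rewrite hE // mulN1r addrC.
Qed.

Lemma feller_ge0 t f x : 0 <= t -> C0 f -> (forall y, O y -> 0 <= f y) -> O x -> 0 <= S t f x.
Proof.
move=> t0 cf f0 Ox; have [B B0 HB] := C0_bounded cf.
have cg : C0 (fun y => B^-1 * f y) by exact: C0_scale.
have /andP[] : 0 <= S t (fun y => B^-1 * f y) x <= 1.
  apply: (feller_contraction HS) => // y Oy /=; apply/andP; split.
    by rewrite mulr_ge0 ?f0 // invr_ge0 ltW.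
  by rewrite mulrC ler_pdivrMr // mul1r (le_trans (ler_norm _) (HB y Oy)).
by rewrite (@feller_scale _ B^-1 f) // pmulr_rge0 // invr_gt0.
Qed.

Lemma feller_mono t f g x : 0 <= t -> C0 f -> C0 g -> (forall y, O y -> f y <= g y) -> O x ->
  S t f x <= S t g x.
Proof.
move=> t0 cf cg fg Ox; rewrite -subr_ge0 -(@feller_sub t g f (fun y => g y - f y)) //.
by apply: feller_ge0 => //; [exact: C0_sub|move=> y Oy; rewrite subr_ge0 fg].
Qed.

Lemma feller_bounded t f C : 0 <= t -> C0 f -> bounded_by C f -> bounded_by C (S t f).
Proof.
move=> t0 cf fC x Ox; have C0' : 0 <= C by apply: le_trans (fC x Ox); exact: normr_ge0.
have cn : C0 (fun y => `|f y|).
  apply: (C0_dominated cf); last by exists 1 => y _; rewrite normr_id mul1r.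
  case: cf => /within_orthantP cf _; apply/within_orthantP => y Oy e e0.
  move: (cf y Oy e e0); apply: filterS => z H Oz; exact: le_trans (ler_dist_dist _ _) (H Oz).
suff Sn : S t (fun y => `|f y|) x <= C.
  rewrite ler_norml; apply/andP; split.
    rewrite lerNl (le_trans _ Sn) //.
    rewrite -mulN1r -(@feller_scale t (-1) f (fun y => -1 * f y)) //.
    by apply: feller_mono => //; [exact: C0_scale|move=> y _; rewrite mulN1r -normrN ler_norm].
  by rewrite (le_trans _ Sn) //; apply: feller_mono => // y _; exact: ler_norm.
(* C may be 0, so the normalization into [0, 1] divides by C + e. *)
apply/ler_addgt0Pr => e e0; have Ce : 0 < C + e by rewrite ltr_wpDl.
have cg : C0 (fun y => (C + e)^-1 * `|f y|) by exact: C0_scale.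
have /andP[_] : 0 <= S t (fun y => (C + e)^-1 * `|f y|) x <= 1.
  apply: (feller_contraction HS) => // y Oy /=; apply/andP; split.
    by rewrite mulr_ge0 // invr_ge0 ltW.
  by rewrite mulrC ler_pdivrMr // mul1r (le_trans (fC y Oy)) // lerDl ltW.
by rewrite (@feller_scale _ (C + e)^-1 (fun y => `|f y|)) // mulrC ler_pdivrMr // mul1r.
Qed.

Lemma feller_dist t f g C : 0 <= t -> C0 f -> C0 g ->
  bounded_by C (fun y => f y - g y) -> bounded_by C (fun y => S t f y - S t g y).
Proof.
move=> t0 cf cg H x Ox; rewrite -(@feller_sub t f g (fun y => f y - g y)) //.
by apply: feller_bounded => //; exact: C0_sub.
Qed.

Lemma feller_strong f e : C0 f -> 0 < e ->
  exists2 d : R, 0 < d & forall t, 0 <= t -> t < d -> bounded_by e (fun x => S t f x - f x).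
Proof.
move=> cf e0; have /near_right0P[d d0 H] := feller_strong_continuity HS cf e0.
exists d => // t t0 td x Ox; move: t0; rewrite le_eqVlt => /predU1P[<-|t0]; last exact: H.
by rewrite (feller_0 HS) // subrr normr0 ltW.
Qed.

(** The semigroup law and the contraction property reduce two times to their difference, so the
    modulus of continuity is uniform in time. *)
Lemma feller_strong_shift f e : C0 f -> 0 < e ->
  exists2 d : R, 0 < d & forall s t, 0 <= s -> 0 <= t -> `|s - t| < d ->
    bounded_by e (fun x => S s f x - S t f x).
Proof.
move=> cf e0; have [d d0 H] := feller_strong cf e0; exists d => // s t.
wlog st : s t / t <= s => [WH s0 t0 std|].
  have [st|/ltW ts] := leP t s; first exact: WH.
  by move=> x Ox; rewrite distrC; apply: (WH t s) => //; rewrite distrC.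
move=> s0 t0 std x Ox.
have -> : S s f x = S t (S (s - t) f) x.
  by rewrite -(feller_D HS) ?subr_ge0 // addrC subrK.
apply: feller_dist => //; first by apply: (feller_C0 HS); rewrite ?subr_ge0.
by apply: H; rewrite ?subr_ge0 // -(@ger0_norm _ (s - t)) ?subr_ge0.
Qed.

Lemma in_generatorP f h : in_generator S f h <->
  [/\ C0 f, C0 h & forall e, 0 < e -> exists2 d : R, 0 < d & forall t, 0 < t -> t < d ->
    bounded_by (e * t) (fun x => S t f x - f x - t * h x)].
Proof.
have E t x c : 0 < t -> (`|(S t f x - f x) / t - h x| <= c) =
    (`|S t f x - f x - t * h x| <= c * t).
  move=> t0; have -> : (S t f x - f x) / t - h x = (S t f x - f x - t * h x) / t.
    by field; rewrite gt_eqF.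
  by rewrite normrM normfV (gtr0_norm t0) ler_pdivrMr.
split=> -[cf ch H]; split=> // e e0.
  have /near_right0P[d d0 Hd] := H e e0; exists d => // t t0 td x Ox.
  by rewrite -E //; exact: Hd.
have [d d0 Hd] := H e e0; apply/near_right0P; exists d => // t t0 td x Ox.
by rewrite E //; exact: Hd.
Qed.

Lemma in_generator_ext f f' h h' : in_generator S f h ->
  (forall x, O x -> f x = f' x) -> (forall x, O x -> h x = h' x) -> in_generator S f' h'.
Proof.
move=> /in_generatorP[cf ch H] ff' hh'; apply/in_generatorP; split.
- exact: C0_ext ff'.
- exact: C0_ext hh'.
move=> e /H[d d0 Hd]; exists d => // t t0 td x Ox.
by rewrite -(feller_ext (ltW t0) cf ff' Ox) -ff' // -hh' //; exact: Hd.
Qed.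

Lemma in_generator_unique f h h' x : in_generator S f h -> in_generator S f h' -> O x -> h x = h' x.
Proof.
move=> /in_generatorP[_ _ H] /in_generatorP[_ _ H'] Ox.
apply/eqP; rewrite -subr_eq0 -normr_eq0 eq_le normr_ge0 andbT.
apply/ler_addgt0Pr => e e0; rewrite add0r.
have [d d0 Hd] := H _ (divr_gt0 e0 (ltr0Sn _ 1)).
have [d' d'0 Hd'] := H' _ (divr_gt0 e0 (ltr0Sn _ 1)).
pose t := Num.min d d' / 2.
have dd : 0 < Num.min d d' by rewrite lt_min d0.
have t0 : 0 < t by rewrite divr_gt0.
have tdd : t < Num.min d d' by rewrite /t; lra.
have [td td'] : t < d /\ t < d' by move: tdd; rewrite lt_min => /andP.
have := Hd t t0 td x Ox; have := Hd' t t0 td' x Ox.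
suff : `|S t f x - f x - t * h' x| <= e / 2 * t -> `|S t f x - f x - t * h x| <= e / 2 * t ->
    t * `|h x - h' x| <= t * e by move=> H1 H2 H3; rewrite -(ler_pM2l t0) H1.
have -> : t * `|h x - h' x| = `|t * h x - t * h' x| by rewrite -mulrBr normrM gtr0_norm.
move: (S t f x - f x) (t * h x) (t * h' x) => a b c; clearbody t.
by rewrite !ler_norml => /andP[? ?] /andP[? ?]; apply/andP; split; lra.
Qed.

Lemma in_generator_orbit s f h : 0 <= s -> in_generator S f h -> in_generator S (S s f) (S s h).
Proof.
move=> s0 /in_generatorP[cf ch H]; apply/in_generatorP; split; try exact: (feller_C0 HS).
move=> e /H[d d0 Hd]; exists d => // t t0 td x Ox; have t0' := ltW t0.
have cSf := feller_C0 HS t0' cf.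
have -> : S t (S s f) x = S s (S t f) x by rewrite -!(feller_D HS) // addrC.
have cf' : C0 (fun y => S t f y - f y) by exact: C0_sub.
rewrite -(@feller_sub s (S t f) f (fun y => S t f y - f y)) //.
rewrite -(@feller_scale s t h (fun y => t * h y)) //.
rewrite -(@feller_sub s _ _ (fun y => S t f y - f y - t * h y)) //; last exact: C0_scale.
by apply: feller_bounded => //; [apply: C0_sub => //; exact: C0_scale|exact: Hd].
Qed.

End feller.

Section primitive.
Context {R : realType}.

Lemma continuous_primitive (G : R -> R) : continuous G ->
  exists Phi : R -> R, forall a b : R, 0 <= a -> a <= b ->
    exists2 c, a <= c <= b & Phi b - Phi a = G c * (b - a).
Proof.
move=> cG; pose Phi (x : R) := (\int[lebesgue_measure]_(t in [set` `[-1, x]]) G t)%R.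
exists Phi => a b a0 ab.
have D (x : R) : 0 <= x -> is_derive x 1 Phi (G x).
  move=> x0; have x1 : x < x + 1 by rewrite ltrDl.
  have Gi : lebesgue_measure.-integrable `[-1, x + 1] (EFin \o G).
    by apply: continuous_compact_integrable; [exact: segment_compact|exact: continuous_subspaceT].
  have [|dF <-] := continuous_FTC1_closed x1 Gi _ (cG x); first lra.
  by rewrite derive1E; exact: derivableP.
have [||c cab E] := @MVT_segment R Phi G a b ab.
- by move=> x; rewrite in_itv /= => /andP[ax _]; apply: D; rewrite (le_trans a0) // ltW.
- apply: derivable_within_continuous => x; rewrite in_itv /= => /andP[ax _].
  by case: (D x (le_trans a0 ax)).
- by exists c => //; rewrite in_itv in cab.
Qed.

End primitive.

(** * Closedness of the generator and density of its domain *)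

Section generator.
Context {R : realType} {L : nat}.
Implicit Types (f g h p q : 'rV[R]_L -> R) (x y : 'rV[R]_L) (s t r e a b : R).

Local Notation O := (@orthant R L).

Context (S : R -> ('rV[R]_L -> R) -> 'rV[R]_L -> R) (HS : feller_semigroup S).

(** Stands for S_t f - f = \int_0^t S_s h ds: at fixed x, the function S_s f - s h has right
    derivative S_s h - h, bounded by C. *)
Lemma in_generator_estimate f h t C : in_generator S f h -> 0 <= t ->
  (forall s, 0 <= s -> s <= t -> bounded_by C (fun x => S s h x - h x)) ->
  bounded_by (C * t) (fun x => S t f x - f x - t * h x).
Proof.
move=> Gfh t0 HC x Ox; have /in_generatorP[cf ch _] := Gfh.
pose F s := S s f x - s * h x.
have -> : S t f x - f x - t * h x = F t - F 0 by rewrite /F (feller_0 HS) //; ring.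
apply: right_derivative_bound => // s s0 st e e0.
  have [d d0 Hd] := feller_strong_shift HS cf (divr_gt0 e0 (ltr0Sn _ 1)).
  have h1 : 0 < `|h x| + 1 by rewrite ltr_pwDr.
  have d1 : 0 < e / (2 * (`|h x| + 1)) by rewrite divr_gt0 // mulr_gt0.
  exists (Num.min d (e / (2 * (`|h x| + 1)))); first by rewrite lt_min d0.
  move=> u u0; rewrite ltrBlDr -ltrBlDl lt_min => /andP[sud sue] us.
  have -> : F s - F u = (S s f x - S u f x) - (s - u) * h x by rewrite /F; ring.
  rewrite (le_trans (ler_normB _ _)) // [leRHS]splitr lerD //.
    by apply: (Hd s u) => //; [exact: ltW|rewrite ger0_norm // subr_ge0].
  rewrite normrM ger0_norm ?subr_ge0 //.
  apply: (@le_trans _ _ (e / (2 * (`|h x| + 1)) * (`|h x| + 1))).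
    by apply: ler_pM; rewrite ?subr_ge0 // ?lerDl // ltW.
  by rewrite le_eqVlt; apply/orP; left; apply/eqP; field; rewrite gt_eqF.
have /in_generatorP[_ _ H] := in_generator_orbit HS s0 Gfh.
have [d d0 Hd] := H e e0; exists d => // r r0 rd.
have E : S (s + r) f x = S r (S s f) x by rewrite addrC (feller_D HS) // ltW.
have -> : F (s + r) - F s = (S r (S s f) x - S s f x - r * S s h x) + r * (S s h x - h x).
  by rewrite /F E; ring.
rewrite (le_trans (ler_normD _ _)) // mulrDl addrC lerD //; last exact: Hd.
by rewrite normrM gtr0_norm // mulrC ler_wpM2r ?(ltW r0) // HC // ltW.
Qed.

Lemma in_generator_closed f h : C0 f -> C0 h ->
  (forall e, 0 < e -> exists p q, [/\ in_generator S p q,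
     bounded_by e (fun x => p x - f x) & bounded_by e (fun x => q x - h x)]) ->
  in_generator S f h.
Proof.
move=> cf ch H; apply/in_generatorP; split=> // e e0.
have [d d0 Hd] := feller_strong HS ch (divr_gt0 e0 (ltr0Sn _ 1)).
exists d => // t t0 td x Ox.
(* Replacing f by p costs 2 e', replacing h by q costs t e', and the estimate for p costs (e / 2 + 2
   e') t; with this e' the total is e t. *)
have e'0 : 0 < e * t / (2 * (2 + 3 * t)) by rewrite divr_gt0 ?mulr_gt0 ?addr_gt0 ?mulr_gt0.
set e' := e * t / _ in e'0.
have e'E : e' * (2 + 3 * t) = e / 2 * t by rewrite /e'; field; rewrite gt_eqF // addr_gt0 ?mulr_gt0.
have [p [q [Gpq pf qh]]] := H e' e'0; have /in_generatorP[cp cq _] := Gpq.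
have HC s : 0 <= s -> s <= t -> bounded_by (e / 2 + 2 * e') (fun x => S s q x - q x).
  move=> s0 st y Oy.
  have := feller_dist HS s0 cq ch qh Oy; have := Hd s s0 (le_lt_trans st td) y Oy; have := qh y Oy.
  by rewrite !ler_norml => /andP[? ?] /andP[? ?] /andP[? ?]; apply/andP; split; lra.
have := in_generator_estimate Gpq (ltW t0) HC Ox.
have := feller_dist HS (ltW t0) cp cf pf Ox; have := pf x Ox.
have := ler_wpM2l (ltW t0) (qh x Ox); rewrite -{1}(gtr0_norm t0) -normrM mulrBr.
move: (S t p x) (S t f x) (p x) (f x) (t * q x) (t * h x) => a1 a2 a3 a4 a5 a6.
rewrite !ler_norml => /andP[? ?] /andP[? ?] /andP[? ?] /andP[? ?].
by apply/andP; split; lra.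
Qed.

Lemma C0_sum n (F : nat -> 'rV[R]_L -> R) : (forall j, C0 (F j)) ->
  C0 (fun y => \sum_(j < n) F j y).
Proof.
move=> cF; elim: n => [|n IHn].
  by apply: C0_ext (@C0_cst0 R L) _ => y _; rewrite big_ord0.
by apply: C0_ext (C0_lincomb 1 (cF n) IHn) _ => y _; rewrite big_ord_recr /= mul1r addrC.
Qed.

Lemma feller_sum t n (F : nat -> 'rV[R]_L -> R) x : 0 <= t -> (forall j, C0 (F j)) -> O x ->
  S t (fun y => \sum_(j < n) F j y) x = \sum_(j < n) S t (F j) x.
Proof.
move=> t0 cF Ox; elim: n => [|n IHn].
  by rewrite big_ord0; apply: (feller_eq0 HS) => [//||y _|//]; [exact: C0_sum|rewrite big_ord0].
rewrite big_ord_recr /= -IHn addrC -[S t (F n) x]mul1r.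
apply: (feller_lincomb HS) => //; first exact: C0_sum.
by move=> y _; rewrite big_ord_recr /= mul1r addrC.
Qed.

(* The functions [a^-1 \int_0^a S_s f ds] lie in the domain and converge to [f]. *)
Lemma in_generator_dense f e : C0 f -> 0 < e ->
  exists p q, in_generator S p q /\ bounded_by e (fun x => p x - f x).
Proof.
move=> cf e0.
have [Phi HPhi] : exists Phi : 'rV[R]_L -> R -> R, forall x, O x -> forall a b, 0 <= a -> a <= b ->
    exists2 c, a <= c <= b & Phi x b - Phi x a = S c f x * (b - a).
  suff /choice[Phi HP] : forall x, exists Phi : R -> R, O x -> forall a b, 0 <= a -> a <= b ->
    exists2 c, a <= c <= b & Phi b - Phi a = S c f x * (b - a) by exists Phi.
  move=> x; have [Ox|nOx] := pselect (O x); last by exists (fun=> 0) => /nOx.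
  (* The absolute value gives a function continuous on the whole line, as S is unconstrained at
     negative times. *)
  have cG : continuous (fun s : R => S `|s| f x).
    move=> s; apply/cvgrPdist_le => e1 e10.
    have [d d0 Hd] := feller_strong_shift HS cf e10.
    near=> u; apply: Hd => //; apply: (le_lt_trans (ler_dist_dist _ _)).
    by near: u; exact: cvgr_dist_lt.
  have [Phi HP] := continuous_primitive cG; exists Phi => _ a b a0 ab.
  have [c /andP[ac cb] ->] := HP a b a0 ab; exists c; rewrite ?ac ?cb //.
  by rewrite ger0_norm // (le_trans a0).
pose I a b x := Phi x b - Phi x a.
(* [I a b] is the pointwise integral of S_s f from a to b. Riemann sums approach it uniformly in the
   state and in a, which gives both that it lies in C_0 and that S_t may be moved inside. *)
have Riemann e1 b : 0 < e1 -> 0 < b -> exists n : nat, (0 < n)%N /\ forall a, 0 <= a ->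
    bounded_by (e1 * b) (fun x => I a (a + b) x - \sum_(j < n) b / n%:R * S (a + j%:R * (b / n%:R)) f x).
  move=> e10 b0; have [d d0 Hd] := feller_strong_shift HS cf e10.
  have bd0 : 0 <= b / d by rewrite divr_ge0 // ltW.
  have [n nbd] : exists n : nat, b / d < n%:R by exists (Num.truncn (b / d)).+1; exact: truncnS_gt.
  have n0 : 0 < n%:R :> R by exact: le_lt_trans nbd.
  have bnd : b / n%:R < d by rewrite ltr_pdivrMr // mulrC -ltr_pdivrMr.
  have bn0 : 0 < b / n%:R by rewrite divr_gt0.
  exists n; split; first by rewrite -(ltr0n R).
  move=> a a0 x Ox; rewrite /I.
  have -> : Phi x (a + b) - Phi x a =
      \sum_(j < n) (Phi x (a + j.+1%:R * (b / n%:R)) - Phi x (a + j%:R * (b / n%:R))).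
    rewrite -(big_mkord xpredT (fun j => Phi x (a + j.+1%:R * (b / n%:R)) - Phi x (a + j%:R * (b / n%:R)))).
    rewrite (telescope_sumr (fun j => Phi x (a + j%:R * (b / n%:R)))) // mul0r addr0.
    by rewrite mulrCA divff ?mulr1 // gt_eqF.
  rewrite -sumrB; apply: (le_trans (ler_norm_sum _ _ _)).
  apply: (@le_trans _ _ (\sum_(j < n) e1 * (b / n%:R))).
    apply: ler_sum => j _; set u := a + j%:R * (b / n%:R).
    have u0 : 0 <= u by rewrite addr_ge0 // mulr_ge0 // ltW.
    have vE : a + j.+1%:R * (b / n%:R) = u + b / n%:R by rewrite /u -natr1; ring.
    rewrite vE; have [|c /andP[uc cv] ->] := HPhi x Ox u (u + b / n%:R) u0; first by rewrite lerDl ltW.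
    have -> : S c f x * (u + b / n%:R - u) - b / n%:R * S u f x = (S c f x - S u f x) * (b / n%:R) by ring.
    rewrite normrM (gtr0_norm bn0) ler_wpM2r ?(ltW bn0) //.
    apply: Hd => //; first exact: le_trans uc.
    rewrite ger0_norm ?subr_ge0 // (le_lt_trans _ bnd) //.
    by rewrite lerBlDl.
  by rewrite sumr_const card_ord -mulrnAr -[_ *+ n]mulr_natr divfK ?gt_eqF.
have cI a b : 0 <= a -> 0 < b -> C0 (I a (a + b)).
  move=> a0 b0; apply: C0_uniform_limit => e1 e10.
  have [n [n0 Hn]] := Riemann (e1 / b) b (divr_gt0 e10 b0) b0.
  exists (fun x => \sum_(j < n) b / n%:R * S (a + j%:R * (b / n%:R)) f x).
    have nonneg j : 0 <= a + j%:R * (b / n%:R) by rewrite addr_ge0 // mulr_ge0 // divr_ge0 // ltW.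
    apply: (@C0_sum n (fun j x => b / n%:R * S (a + j%:R * (b / n%:R)) f x)) => j.
    exact/C0_scale/(feller_C0 HS).
  move=> x Ox; rewrite distrC; have := Hn a a0 x Ox; by rewrite divfK // gt_eqF.
have SI t b x : 0 <= t -> 0 < b -> O x -> S t (I 0 b) x = I t (t + b) x.
  move=> t0 b0 Ox; apply/eqP; rewrite -subr_eq0 -normr_eq0 eq_le normr_ge0 andbT.
  apply/ler_addgt0Pr => e1 e10; rewrite add0r.
  have [n [n0 Hn]] := Riemann (e1 / (2 * b)) b (divr_gt0 e10 (mulr_gt0 (ltr0Sn _ 1) b0)) b0.
  have eE : e1 / (2 * b) * b = e1 / 2 by field; rewrite gt_eqF.
  have nonneg a j : 0 <= a -> 0 <= a + j%:R * (b / n%:R).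
    by move=> a0; rewrite addr_ge0 // mulr_ge0 // divr_ge0 // ltW.
  pose T a j x := b / n%:R * S (a + j%:R * (b / n%:R)) f x.
  have cT a j : 0 <= a -> C0 (T a j) by move=> a0; apply/C0_scale/(feller_C0 HS) => //; exact: nonneg.
  have cs := C0_sum n (fun j => cT 0 j (lexx 0)).
  have Es := feller_sum n t0 (fun j => cT 0 j (lexx 0)) Ox.
  have cI0 : C0 (I 0 b) by rewrite -[b]add0r; exact: cI.
  have H0 : bounded_by (e1 / 2) (fun x => I 0 b x - \sum_(j < n) T 0 j x).
    by move=> y Oy; have := Hn 0 (lexx 0) y Oy; rewrite eE add0r.
  have := feller_dist HS t0 cI0 cs H0 Ox; have := Hn t t0 x Ox; rewrite eE Es.
  have -> : \sum_(j < n) S t (T 0 j) x = \sum_(j < n) b / n%:R * S (t + j%:R * (b / n%:R)) f x.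
    apply: eq_bigr => j _.
    rewrite (@feller_scale _ _ _ HS t (b / n%:R) (S (0 + j%:R * (b / n%:R)) f) (T 0 j)) //;
      last by apply: (feller_C0 HS) => //; exact: nonneg.
    by rewrite -(feller_D HS) //; [rewrite add0r|exact: nonneg].
  move: (\sum_(j < n) _) (S t (I 0 b) x) (I t (t + b) x) => a1 a2 a3.
  by rewrite !ler_norml => /andP[? ?] /andP[? ?]; apply/andP; split; lra.
have [d d0 Hd] := feller_strong HS cf e0.
pose b := d / 2; have b0 : 0 < b by rewrite divr_gt0.
have bd : b < d by rewrite /b; lra.
have cI0 : C0 (I 0 b) by rewrite -[b]add0r; exact: cI.
exists (fun x => b^-1 * I 0 b x), (fun x => b^-1 * (S b f x - f x)); split.
  apply/in_generatorP; split; [exact: C0_scale| |].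
    by apply/C0_scale/C0_sub => //; apply: (feller_C0 HS) => //; exact: ltW.
  move=> e1 e10; have eb : 0 < e1 * b / 2 by rewrite divr_gt0 // mulr_gt0.
  have [d1 d10 Hd1] := feller_strong_shift HS cf eb.
  exists d1 => // t t0 td x Ox.
  rewrite (@feller_scale _ _ _ HS t b^-1 (I 0 b)) ?(ltW t0) // SI ?(ltW t0) //.
  (* Shifting the window leaves only two end pieces of length t, near the times b and 0; hence the
     derivative (S_b f - f) / b. *)
  have -> : b^-1 * I t (t + b) x - b^-1 * I 0 b x - t * (b^-1 * (S b f x - f x)) =
    b^-1 * ((Phi x (b + t) - Phi x b) - (Phi x t - Phi x 0) - t * (S b f x - f x)).
    by rewrite /I (addrC t b); ring.
  have [|c /andP[bc ct] ->] := HPhi x Ox b (b + t) (ltW b0); first by rewrite lerDl ltW.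
  have [|c' /andP[c'0 c't] ->] := HPhi x Ox 0 t (lexx 0); first exact: ltW.
  have -> : S c f x * (b + t - b) - S c' f x * (t - 0) - t * (S b f x - f x) =
    t * ((S c f x - S b f x) - (S c' f x - S 0 f x)) by rewrite (feller_0 HS) //; ring.
  rewrite !normrM normfV (gtr0_norm b0) (gtr0_norm t0) mulrC ler_pdivrMr // mulrC.
  rewrite [leRHS](_ : _ = (e1 * b / 2 + e1 * b / 2) * t); last by rewrite -splitr mulrAC.
  rewrite mulrC [leRHS]mulrC; apply: ler_pM => //; first exact: ltW.
  rewrite (le_trans (ler_normB _ _)) // lerD //.
    apply: Hd1 => //; [exact: le_trans (ltW b0) bc|exact: ltW|].
    by rewrite ger0_norm ?subr_ge0 // (le_lt_trans _ td) // lerBlDl.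
  by apply: Hd1 => //; rewrite subr0 ger0_norm // (le_lt_trans c't).
move=> x Ox; have [|c /andP[c0 cb] cE] := HPhi x Ox 0 b (lexx 0); first exact: ltW.
rewrite /I cE subr0 mulrC mulfK ?gt_eqF //.
by apply: Hd => //; exact: le_lt_trans bd.
Unshelve. all: by end_near. Qed.

End generator.

(** * Operators commuting with a semigroup *)

Section commutation.
Context {R : realType} {L : nat}.
Implicit Types (f g h p q : 'rV[R]_L -> R) (x y : 'rV[R]_L) (s t r e a b : R).

Local Notation O := (@orthant R L).

Context (S : R -> ('rV[R]_L -> R) -> 'rV[R]_L -> R) (HS : feller_semigroup S).
Context (A : ('rV[R]_L -> R) -> 'rV[R]_L -> R) (HA : generator_acts_on_core S A).
Context (w : 'rV[R]_L -> R) (theta : 'rV[R]_L -> 'rV[R]_L).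
Context (w_le1 : bounded_by 1 w) (theta_orthant : forall x, O x -> O (theta x)).
Context (J_C0 : forall f, C0 f -> C0 (fun x => w x * f (theta x))).
Context (J_core : forall q, test_function q ->
  in_generator S (fun x => w x * q (theta x)) (fun x => w x * A q (theta x))).

Local Notation J f := (fun x => w x * f (theta x)).

Let J_bounded f C : bounded_by C f -> bounded_by C (J f).
Proof.
move=> fC x Ox; rewrite normrM -[leRHS]mul1r.
by apply: ler_pM => //; [exact: w_le1|exact/fC/theta_orthant].
Qed.

(** The core property approximates f and h together, J is bounded, and the generator is closed. *)
Let J_generator f h : in_generator S f h -> in_generator S (J f) (J h).
Proof.
move=> Gfh; have [cf ch _] := Gfh.
apply: (in_generator_closed HS); [exact: J_C0|exact: J_C0|] => e e0.
have [q [tq qf Aqh]] := HA.2 f h Gfh e e0.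
exists (J q), (J (A q)); split; first exact: J_core.
- by move=> x Ox; rewrite -mulrBr; exact: (J_bounded (f := fun y => q y - f y)).
- by move=> x Ox; rewrite -mulrBr; exact: (J_bounded (f := fun y => A q y - h y)).
Qed.

(* [s |-> S_(t-s) (J (S_s f)) x] has zero right derivative on the domain of the generator. *)
Let J_commute_generator f h t x : in_generator S f h -> 0 <= t -> O x ->
  S t (J f) x = w x * S t f (theta x).
Proof.
move=> Gfh t0 Ox; have [cf _ _] := Gfh.
pose F s := S (t - s) (J (S s f)) x.
have cS s : 0 <= s -> C0 (S s f) by move=> s0; exact: (feller_C0 HS).
have cJS s : 0 <= s -> C0 (J (S s f)) by move=> s0; exact/J_C0/cS.
(* F 0 is S_t (J f) x and F t is w x times S_t f at theta x. *)
suff : `|F t - F 0| <= 0 * t.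
  rewrite mul0r normr_le0 subr_eq0 /F subrr subr0 => /eqP E.
  rewrite (feller_0 HS) // in E; last exact: cJS.
  rewrite E; apply: (feller_ext HS) => //; first exact: J_C0.
  by move=> y Oy; rewrite (feller_0 HS) //; exact: theta_orthant.
apply: right_derivative_bound => // s s0 st e e0.
  have s0' := ltW s0.
  have [d1 d10 H1] := feller_strong_shift HS cf (divr_gt0 e0 (ltr0Sn _ 1)).
  have [d2 d20 H2] := feller_strong HS (cJS s s0') (divr_gt0 e0 (ltr0Sn _ 1)).
  exists (Num.min d1 d2); first by rewrite lt_min d10.
  move=> u u0; rewrite ltrBlDr -ltrBlDl lt_min => /andP[sud1 sud2] us.
  have su0 : 0 <= s - u by rewrite subr_ge0.
  have ts0 : 0 <= t - s by rewrite subr_ge0.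
  have cJu := cJS u u0.
  have -> : F u = S (t - s) (S (s - u) (J (S u f))) x.
    by rewrite /F -(feller_D HS) //; congr S; ring.
  apply: (feller_dist HS) => //; [exact: cJS|exact: (feller_C0 HS)|move=> y Oy /=].
  have K1 := H2 (s - u) su0 sud2 y Oy.
  have K2 : `|S (s - u) (J (S s f)) y - S (s - u) (J (S u f)) y| <= e / 2.
    apply: (feller_dist HS (C := e / 2)) => //; first exact: cJS.
    move=> z Oz; rewrite -mulrBr; apply: (J_bounded (f := fun y => S s f y - S u f y)) => //.
    by apply: H1 => //; rewrite ger0_norm.
  move: K1 K2; move: (S (s - u) _ _) (S (s - u) _ _) (w y * _) => a1 a2 a3.
  by rewrite !ler_norml => /andP[? ?] /andP[? ?]; apply/andP; split; lra.
have Gs := in_generator_orbit HS s0 Gfh.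
have /in_generatorP[_ _ H1] := Gs.
have /in_generatorP[_ _ H2] := J_generator Gs.
have [d1 d10 K1] := H1 _ (divr_gt0 e0 (ltr0Sn _ 1)).
have [d2 d20 K2] := H2 _ (divr_gt0 e0 (ltr0Sn _ 1)).
exists (Num.min (Num.min d1 d2) (t - s)); first by rewrite !lt_min d10 d20 subr_gt0.
move=> r r0; rewrite !lt_min => /andP[/andP[rd1 rd2] rts].
have tsr0 : 0 <= t - (s + r) by rewrite subr_ge0 -lerBrDl ltW.
have cJs := cJS s s0.
have -> : F s = S (t - (s + r)) (S r (J (S s f))) x.
  by rewrite /F -(feller_D HS) // ?(ltW r0) //; congr S; ring.
have sr0 : 0 <= s + r by rewrite addr_ge0 // ltW.
rewrite add0r; apply: (feller_dist HS) => //; first exact: cJS.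
  by apply: (feller_C0 HS) => //; exact: ltW.
move=> y Oy /=; have Oty := theta_orthant Oy.
rewrite [s + r]addrC (feller_D HS) ?(ltW r0) //.
(* Both increments have the same first-order term r J (S_s h), so their difference is at most e
   r. *)
have := J_bounded (K1 r r0 rd1) Oy; have := K2 r r0 rd2 y Oy; rewrite !mulrBr mulrCA.
move: (w y * S r _ _) (S r _ _) (w y * S s f _) (r * _) => a1 a2 a3 a4.
by rewrite !ler_norml => /andP[? ?] /andP[? ?]; apply/andP; split; lra.
Qed.

(** Both sides are bounded in f, and the domain of the generator is dense. *)
Lemma feller_commute f t x : C0 f -> 0 <= t -> O x -> S t (J f) x = w x * S t f (theta x).
Proof.
move=> cf t0 Ox; apply/eqP; rewrite -subr_eq0 -normr_eq0 eq_le normr_ge0 andbT.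
apply/ler_addgt0Pr => e e0; rewrite add0r.
have [p [h [Gph pf]]] := in_generator_dense HS cf (divr_gt0 e0 (ltr0Sn _ 1)).
have [cp _ _] := Gph.
have H1 : `|S t (J p) x - S t (J f) x| <= e / 2.
  apply: (feller_dist HS (C := e / 2)) => //; try exact: J_C0.
  by move=> y Oy; rewrite -mulrBr; exact: (J_bounded pf).
have H2 := J_bounded (feller_dist HS t0 cp cf pf) Ox.
move: H1 H2; rewrite (J_commute_generator Gph) // mulrBr.
move: (w x * S t p _) (S t _ x) (w x * S t f _) => a1 a2 a3.
by rewrite !ler_norml => /andP[? ?] /andP[? ?]; apply/andP; split; lra.
Qed.

End commutation.

(** * Exponential reparametrization of the energies *)

Section exponential_change.
Context {R : realType} (sigma : R) (sigma_gt0 : 0 < sigma).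
Implicit Types (e w r lam mu : R).

Local Notation W := (Wfun sigma).
Notation diffn1 := (diffn (fun _ : unit => 1 : R)).

Let s2_gt0 : 0 < 2 * sigma. Proof. by rewrite mulr_gt0. Qed.

(** Inverse of [Wfun], meaningful only where 2 sigma w < 1; this bound therefore accompanies every
    use. *)
Definition Vfun w : R := - ln (1 - 2 * sigma * w) / (2 * sigma).

Lemma Wfun0 : W 0 = 0. Proof. by rewrite /Wfun mulr0 expR0 subrr mul0r. Qed.

Lemma Vfun0 : Vfun 0 = 0. Proof. by rewrite /Vfun mulr0 subr0 ln1 oppr0 mul0r. Qed.

Lemma WfunE e : 1 - 2 * sigma * W e = expR (- 2 * sigma * e).
Proof. by rewrite /Wfun; move: (expR _) => a; field; rewrite gt_eqF. Qed.

Lemma Wfun_lt e : 2 * sigma * W e < 1.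
Proof. by rewrite -subr_gt0 WfunE expR_gt0. Qed.

Lemma WfunK : cancel W Vfun.
Proof. by move=> e; rewrite /Vfun WfunE expRK; field; rewrite gt_eqF. Qed.

Lemma VfunK w : 2 * sigma * w < 1 -> W (Vfun w) = w.
Proof.
move=> w1; rewrite /Wfun /Vfun.
have -> : - 2 * sigma * (- ln (1 - 2 * sigma * w) / (2 * sigma)) = ln (1 - 2 * sigma * w).
  by field; rewrite gt_eqF.
by rewrite lnK ?posrE ?subr_gt0 //; field; rewrite gt_eqF.
Qed.

Lemma Wfun_le e e' : e <= e' -> W e <= W e'.
Proof.
move=> ee'; rewrite /Wfun ler_pM2r ?invr_gt0 // lerD2l lerN2 ler_expR.
by rewrite !mulNr lerN2 ler_wpM2l // ltW.
Qed.

Lemma Wfun_ge0 e : 0 <= e -> 0 <= W e.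
Proof. by move=> e0; rewrite -Wfun0 Wfun_le. Qed.

Lemma Wfun_lt_mono e e' : e < e' -> W e < W e'.
Proof.
move=> ee'; rewrite lt_neqAle Wfun_le ?ltW // andbT; apply/eqP => /(can_inj WfunK) E.
by rewrite E ltxx in ee'.
Qed.

Lemma Vfun_le w w' : w <= w' -> 2 * sigma * w' < 1 -> Vfun w <= Vfun w'.
Proof.
move=> ww' w'1; rewrite /Vfun ler_pM2r ?invr_gt0 // lerN2 ler_ln ?posrE ?subr_gt0 //.
  by rewrite lerD2l lerN2 ler_wpM2l // ltW.
by apply: le_lt_trans w'1; rewrite ler_wpM2l // ltW.
Qed.

Lemma Wfun_continuous : continuous W.
Proof.
move=> e; apply/differentiable_continuous.
have := diffn_differentiable e (diffn1_scaleW sigma 0 1).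
by rewrite (_ : (fun e => 1 * W e) = W) //; apply/funext => ?; rewrite mul1r.
Qed.

Lemma Vfun_continuous w : 2 * sigma * w < 1 -> {for w, continuous Vfun}.
Proof.
move=> w1; have w0 : 0 < 1 - 2 * sigma * w by rewrite subr_gt0.
rewrite /Vfun; apply: cvgMl; apply: cvgN.
apply: (@continuous_comp _ _ _ (fun w => 1 - 2 * sigma * w) (@ln R)).
  by apply: cvgB; [exact: cvg_cst|apply: cvgMr; exact: cvg_id].
exact: continuous_ln.
Qed.

Lemma scale_Wfun_lt r e : 0 <= r -> r <= 1 -> 2 * sigma * (r * W e) < 1.
Proof.
move=> r0 r1; have H := Wfun_lt e; rewrite mulrCA.
have [We0|/ltW We0] := leP 0 (2 * sigma * W e).
  by apply: le_lt_trans H; rewrite ler_piMl.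
by apply: (@le_lt_trans _ _ 0) => //; rewrite mulr_ge0_le0.
Qed.

(** A smooth monotone substitute for min(w, b), exact below a. It keeps the argument of [Vfun] away
    from its singularity. *)
Definition smooth_cap (a b w : R) : R := b - (b - w) * smooth_step ((w - a) / (b - a)).

Lemma smooth_cap_id a b w : a < b -> w <= a -> smooth_cap a b w = w.
Proof.
move=> ab wa; rewrite /smooth_cap smooth_step1 ?mulr1 ?subKr //.
by rewrite mulr_le0_ge0 ?invr_ge0 ?subr_ge0 ?subr_le0 // ltW.
Qed.

Let step0 a b w : a < b -> b <= w -> smooth_step ((w - a) / (b - a)) = 0.
Proof. by move=> ab bw; rewrite smooth_step0 // ler_pdivlMr ?subr_gt0 // mul1r lerD2r. Qed.

Lemma smooth_cap_le a b w : a < b -> smooth_cap a b w <= b.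
Proof.
move=> ab; rewrite /smooth_cap gerBl; have [wb|bw] := leP w b.
  by rewrite mulr_ge0 ?subr_ge0 ?smooth_step_ge0.
by rewrite step0 ?mulr0 // ltW.
Qed.

Lemma smooth_cap_nondecr a b w w' : a < b -> w <= w' -> smooth_cap a b w <= smooth_cap a b w'.
Proof.
move=> ab ww'; have [bw'|w'b] := leP b w'.
  by rewrite {2}/smooth_cap step0 // mulr0 subr0 smooth_cap_le.
(* Below b, both b - w and the step are nonnegative and nonincreasing in w. *)
rewrite /smooth_cap lerD2l lerN2; apply: ler_pM; rewrite ?subr_ge0 ?smooth_step_ge0 ?(ltW w'b) //.
  by rewrite lerD2l lerN2.
by apply: smooth_step_nincr; rewrite ler_pM2r ?invr_gt0 ?subr_gt0 // lerD2r.
Qed.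

Lemma diffn1_smooth_cap n a b : diffn1 n (smooth_cap a b).
Proof.
apply: diffnB; first exact: diffn_cst.
apply: diffnM; first by apply: diffnB; [exact: diffn_cst|exact: diffn1_id].
apply: diffn_comp1; first exact: diffn1_smooth_step.
by apply: diffnM; [apply: diffnB; [exact: diffn1_id|]|]; exact: diffn_cst.
Qed.

Lemma diffn1_Vfun_comp n (h : R -> R) : (forall w, 2 * sigma * h w < 1) -> diffn1 n h ->
  diffn1 n (fun w => Vfun (h w)).
Proof.
move=> h1 Hh; apply: diffnM; last exact: diffn_cst.
apply/diffnN/diffn1_ln => [w|]; first by rewrite subr_gt0.
by apply: diffnB; [exact: diffn_cst|apply: diffnM => //; exact: diffn_cst].
Qed.

(** The squared distance keeps it smooth at the centre; the radius of the support is k^(-1/2). *)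
Definition bump (c k e : R) : R := smooth_step (k * (e - c) ^+ 2).

Lemma bump_center c k : bump c k c = 1.
Proof. by rewrite /bump subrr expr0n mulr0 smooth_step1. Qed.

Lemma bump_eq0 c k e : 1 <= k * (e - c) ^+ 2 -> bump c k e = 0.
Proof. exact: smooth_step0. Qed.

Lemma diffn1_bump n c k : diffn1 n (bump c k).
Proof.
apply: diffn_comp1; first exact: diffn1_smooth_step.
apply: diffnM; first exact: diffn_cst.
by apply: diffnM; (apply: diffnB; [exact: diffn1_id|exact: diffn_cst]).
Qed.

Lemma bump_continuous c k : continuous (bump c k).
Proof.
by move=> e; exact/differentiable_continuous/(diffn_differentiable _ (diffn1_bump 0 c k)).
Qed.

(** 1 + 1/k exceeds the radius k^(-1/2) without a square root, since (1 + u)^2 >= u for u = 1/k. *)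
Lemma bump_far c k e : 0 < k -> c + 1 + k^-1 <= e -> bump c k e = 0.
Proof.
move=> k0 ce; apply: bump_eq0; rewrite mulrC -ler_pdivrMr // mul1r.
have k1 : 0 < k^-1 by rewrite invr_gt0.
have H : 1 + k^-1 <= e - c by lra.
by rewrite expr2; move: k^-1 (e - c) k1 H => u v; nra.
Qed.

End exponential_change.

Section exponential_maps.
Context {R : realType} {L : nat} (sigma : R) (sigma_gt0 : 0 < sigma).
Implicit Types (x y z : 'rV[R]_L) (lam mu r : R).

Local Notation O := (@orthant R L).
Local Notation W := (Wfun sigma).
Local Notation V := (Vfun sigma).

(** With g = [gmap sigma], these three maps are lam g(x), g^-1(z / lam) and g^-1(r g(x)). *)
Definition scaled_gmap lam : 'rV[R]_L -> 'rV[R]_L := tmap (fun e => lam * W e).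
Definition scaled_ginv lam : 'rV[R]_L -> 'rV[R]_L := tmap (fun w => V (w / lam)).
Definition dilation r : 'rV[R]_L -> 'rV[R]_L := tmap (fun e => V (r * W e)).

Local Notation sc := scaled_gmap.
Local Notation us := scaled_ginv.
Local Notation dil := dilation.

Lemma energy_scaled_gmap lam m x : energy m (sc lam x) = lam * W (energy m x).
Proof. by rewrite energy_tmap // Wfun0 mulr0. Qed.

Lemma energy_scaled_ginv lam m z : energy m (us lam z) = V (energy m z / lam).
Proof. by rewrite energy_tmap // mul0r Vfun0. Qed.

Lemma energy_dilation r m x : energy m (dil r x) = V (r * W (energy m x)).
Proof. by rewrite energy_tmap // Wfun0 mulr0 Vfun0. Qed.

Lemma scaled_gmap_orthant lam x : 0 <= lam -> O x -> O (sc lam x).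
Proof. by move=> l0; apply: orthant_tmap => a b _ ab _; rewrite ler_wpM2l // Wfun_le. Qed.

Lemma scaled_ginv_orthant lam z : 0 < lam -> 2 * sigma * (energy 0 z / lam) < 1 ->
  O z -> O (us lam z).
Proof.
move=> l0 zl; apply: orthant_tmap => a b _ ab bz; apply: Vfun_le => //.
  by rewrite ler_wpM2r // invr_ge0 ltW.
by apply: le_lt_trans zl; rewrite ler_wpM2l ?mulr_ge0 ?(ltW sigma_gt0) // ler_wpM2r // invr_ge0 ltW.
Qed.

Lemma dilation_orthant r x : 0 <= r -> r <= 1 -> O x -> O (dil r x).
Proof.
move=> r0 r1; apply: orthant_tmap => a b _ ab _; apply: Vfun_le => //.
  by rewrite ler_wpM2l // Wfun_le.
exact: scale_Wfun_lt.
Qed.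

Lemma scaled_gmapK lam x : 0 < lam -> us lam (sc lam x) = x.
Proof.
move=> l0; rewrite /us /sc tmap_comp ?Wfun0 ?mulr0 // -[RHS]tmap_id.
by apply: eq_tmap => m; rewrite mulrAC divff ?gt_eqF // mul1r WfunK.
Qed.

Lemma scaled_ginvK lam z : 0 < lam -> 2 * sigma * (energy 0 z / lam) < 1 -> O z ->
  sc lam (us lam z) = z.
Proof.
move=> l0 zl Oz; rewrite /us /sc tmap_comp ?mul0r ?Vfun0 // -[RHS]tmap_id.
apply: eq_tmap => m; rewrite (VfunK sigma_gt0); first by rewrite mulrC divfK ?gt_eqF.
apply: le_lt_trans zl; rewrite ler_wpM2l ?mulr_ge0 ?(ltW sigma_gt0) //.
by rewrite ler_wpM2r ?invr_ge0 ?(ltW l0) // orthant_energy_le.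
Qed.

Lemma scaled_gmap_dilation lam mu x : 0 < lam -> lam <= mu ->
  sc mu (dil (lam / mu) x) = sc lam x.
Proof.
move=> l0 lm; have m0 := lt_le_trans l0 lm.
rewrite /sc /dil tmap_comp ?Wfun0 ?mulr0 ?Vfun0 //; apply: eq_tmap => m.
rewrite (VfunK sigma_gt0); first by field; rewrite gt_eqF.
by apply: scale_Wfun_lt; rewrite ?divr_ge0 ?ler_pdivrMr ?mul1r // ltW.
Qed.

Lemma scaled_gmap_continuous lam : continuous (sc lam).
Proof. by move=> x; apply: tmap_continuous => m; apply: cvgMr; exact: Wfun_continuous. Qed.

Lemma dilation_continuous r : 0 <= r -> r <= 1 -> continuous (dil r).
Proof.
move=> r0 r1 x; apply: tmap_continuous => m.
apply: (@continuous_comp _ _ _ (fun e => r * W e) V).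
  by apply: cvgMr; exact: Wfun_continuous.
exact/Vfun_continuous/scale_Wfun_lt.
Qed.

Lemma scaled_ginv_continuous lam z : 0 < lam -> 2 * sigma * (energy 0 z / lam) < 1 -> O z ->
  {for z, continuous (us lam)}.
Proof.
move=> l0 zl Oz; apply: tmap_continuous => m.
apply: (@continuous_comp _ _ _ (fun w : R => w / lam) V); first by apply: cvgMl; exact: cvg_id.
apply: Vfun_continuous => //; apply: le_lt_trans zl.
rewrite ler_wpM2l ?mulr_ge0 ?(ltW sigma_gt0) //.
by rewrite ler_wpM2r ?invr_ge0 ?(ltW l0) // orthant_energy_le.
Qed.

End exponential_maps.

(** * Scale invariance and conservation of energy *)

Section pullback.
Context {R : realType} {L : nat} (sigma : R) (sigma_gt0 : 0 < sigma).
Implicit Types (x y z : 'rV[R]_L) (lam mu r M : R) (f p q : 'rV[R]_L -> R).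

Local Notation O := (@orthant R L).
Local Notation W := (Wfun sigma).
Local Notation V := (Vfun sigma).
Local Notation sc := (@scaled_gmap R L sigma).
Local Notation us := (@scaled_ginv R L sigma).
Local Notation dil := (@dilation R L sigma).

Lemma test_functionP f : test_function f <->
  smooth f /\ exists2 M, 0 <= M & forall x, O x -> M <= energy 0 x -> f x = 0.
Proof.
split=> [[sf [M HM]]|[sf [M M0 HM]]]; split=> //.
  exists (L%:R * (`|M| + 1) + 1); first by rewrite addr_ge0 // mulr_ge0 // addr_ge0.
  move=> x Ox Mx; apply: HM => //; rewrite ltNge; apply/negP => xM.
  have := le_trans Mx (orthant_energy_le_norm Ox); rewrite leNgt => /negP; apply.
  apply: (@le_lt_trans _ _ (L%:R * (`|M| + 1))); last by rewrite ltrDl.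
  by rewrite ler_wpM2l // (le_trans xM) // (le_trans (ler_norm M)) // lerDl.
by exists M => x Ox Mx; apply: HM => //; apply: (le_trans (ltW Mx)); exact: orthant_norm_le.
Qed.

(** The bound on M / lam says that the energies in the support of p stay strictly below those missed
    by [sc lam], so the pulled-back support is bounded. *)
Lemma test_function_scaled p lam M : 0 < lam -> smooth p -> 2 * sigma * (M / lam) < 1 ->
  (forall z, O z -> M <= energy 0 z -> p z = 0) -> test_function (fun x => p (sc lam x)).
Proof.
move=> l0 sp Ml p0; apply/test_functionP; split.
  by apply: smooth_tmap => // n; exact: diffn1_scaleW.
exists (Num.max 0 (V (M / lam))); first by rewrite le_max lexx.
move=> x Ox; rewrite ge_max => /andP[_ Vx]; apply: p0; first exact: scaled_gmap_orthant (ltW l0) Ox.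
rewrite energy_scaled_gmap mulrC -ler_pdivrMr // -(VfunK sigma_gt0 Ml).
exact: Wfun_le.
Qed.

Lemma test_function_pullback q mu : 0 < mu -> test_function q ->
  exists p M, [/\ test_function p, 2 * sigma * (M / mu) < 1,
    (forall z, O z -> M <= energy 0 z -> p z = 0) &
    (forall x, O x -> p (sc mu x) = q x)].
Proof.
move=> mu0 /test_functionP[sq [K K0 HK]].
have ab : W (K + 1) < W (K + 2) by apply: Wfun_lt_mono => //; lra.
pose zeta := smooth_cap (W (K + 1)) (W (K + 2)).
have z1 w : 2 * sigma * zeta w < 1.
  apply: le_lt_trans (Wfun_lt sigma_gt0 (K + 2)); rewrite ler_wpM2l ?mulr_ge0 ?(ltW sigma_gt0) //.
  exact: smooth_cap_le.
(* The inverse of mu W, capped between the images of K + 1 and K + 2: it is exact up to energy K +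
   1, and beyond that q, supported below K, vanishes on both sides. *)
pose h w := V (zeta (w / mu)).
have h_nondecr a b : a <= b -> h a <= h b.
  move=> leab; apply: Vfun_le => //; apply: smooth_cap_nondecr => //.
  by rewrite ler_wpM2r // invr_ge0 ltW.
have WK0 : 0 <= W (K + 1) by apply: Wfun_ge0 => //; rewrite addr_ge0.
have h0 : h 0 = 0 by rewrite /h mul0r /zeta smooth_cap_id // Vfun0.
have hW e : e <= K + 1 -> h (mu * W e) = e.
  move=> eK; rewrite /h mulrAC divff ?gt_eqF // mul1r /zeta smooth_cap_id ?WfunK //.
  exact: Wfun_le.
pose p z := q (tmap h z).
have p0 z : O z -> mu * W (K + 1) <= energy 0 z -> p z = 0.
  move=> Oz Mz; apply: HK; first by apply: orthant_tmap => // a b _ leab _; exact: h_nondecr.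
  rewrite energy_tmap //; apply: (@le_trans _ _ (K + 1)); first by rewrite lerDl.
  by rewrite -{1}(hW (K + 1)) // h_nondecr.
exists p, (mu * W (K + 1)); split=> //.
- apply/test_functionP; split.
    apply: smooth_tmap => // n; apply: diffn1_Vfun_comp => //.
    apply: diffn_comp1; first exact: diffn1_smooth_cap.
    by apply: diffnM; [exact: diffn1_id|exact: diffn_cst].
  by exists (mu * W (K + 1)) => //; rewrite mulr_ge0 // ltW.
- by rewrite (mulrC mu) mulfK ?gt_eqF // Wfun_lt.
move=> x Ox; have [xK|Kx] := leP (energy 0 x) (K + 1).
  rewrite /p /scaled_gmap tmap_comp ?Wfun0 ?mulr0 //; congr q.
  rewrite -[RHS]tmap_id; apply: eq_tmap => m; rewrite hW //.
  by apply: le_trans xK; exact: orthant_energy_le.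
rewrite [RHS]HK //; last by rewrite (le_trans _ (ltW Kx)) // lerDl.
apply: p0; first exact: scaled_gmap_orthant (ltW mu0) Ox.
by rewrite energy_scaled_gmap ler_wpM2l ?(ltW mu0) // Wfun_le // ltW.
Qed.

End pullback.

Section abep_semigroup.
Context {R : realType} {L : nat} (sigma k : R) (sigma_gt0 : 0 < sigma).
Implicit Types (f p q phi psi : 'rV[R]_L -> R) (x y z : 'rV[R]_L) (t lam mu r c M : R).

Local Notation O := (@orthant R L).
Local Notation W := (Wfun sigma).
Local Notation V := (Vfun sigma).
Local Notation sc := (@scaled_gmap R L sigma).
Local Notation us := (@scaled_ginv R L sigma).
Local Notation dil := (@dilation R L sigma).
Local Notation ABEP := (@abep_generator R L sigma k).
Local Notation BEP := (@bep_generator R L k).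

Context (S : R -> ('rV[R]_L -> R) -> 'rV[R]_L -> R) (HS : feller_semigroup S).
Context (HA : generator_acts_on_core S ABEP).

Lemma in_generator_scaled p lam M : 0 < lam -> smooth p -> 2 * sigma * (M / lam) < 1 ->
  (forall z, O z -> M <= energy 0 z -> p z = 0) ->
  in_generator S (fun x => p (sc lam x)) (fun x => BEP p (sc lam x)).
Proof.
move=> l0 sp Ml p0; have H := HA.1 _ (test_function_scaled sigma_gt0 l0 sp Ml p0).
apply: (in_generator_ext HS H) => x _; first by [].
exact: (abep_generator_scaleW k sigma_gt0 lam x sp).
Qed.

(** p o [sc lam] and q agree on the orthant only; that their generators agree up to the boundary
    comes from the uniqueness of the limit defining the generator. *)
Lemma bep_generator_scaled p q lam M : 0 < lam -> smooth p -> 2 * sigma * (M / lam) < 1 ->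
  (forall z, O z -> M <= energy 0 z -> p z = 0) -> test_function q ->
  (forall x, O x -> p (sc lam x) = q x) ->
  forall x, O x -> BEP p (sc lam x) = ABEP q x.
Proof.
move=> l0 sp Ml p0 tq pq x Ox; have Gp := in_generator_scaled l0 sp Ml p0.
have Gq : in_generator S q (fun x => BEP p (sc lam x)) by exact: (in_generator_ext HS Gp pq).
exact: (in_generator_unique Gq (HA.1 _ tq)).
Qed.

(** If p extends q through [sc mu], then q o [dil (lam / mu)] is p o [sc lam]. Both pullbacks of p
    are governed by the BEP generator, and the bump, a function of the total energy, passes through
    the ABEP generator. *)
Lemma in_generator_dilated q c kappa lam mu : 0 < lam -> lam <= mu -> 0 < kappa ->
  test_function q ->
  in_generator S (fun x => bump c kappa (energy 0 x) * q (dil (lam / mu) x))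
                 (fun x => bump c kappa (energy 0 x) * ABEP q (dil (lam / mu) x)).
Proof.
move=> l0 lm k0 tq; have m0 := lt_le_trans l0 lm.
have r0 : 0 <= lam / mu by apply: divr_ge0; exact: ltW.
have r1 : lam / mu <= 1 by rewrite ler_pdivrMr // mul1r.
have [p [M [[sp _] Mm p0 pq]]] := test_function_pullback sigma_gt0 m0 tq.
have Aq := bep_generator_scaled m0 sp Mm p0 tq pq.
have sb n : diffn (fun _ : unit => 1 : R) n (bump c kappa) by exact: diffn1_bump.
have ssc : smooth (fun x => p (sc lam x)).
  by apply: smooth_tmap => // n; exact: diffn1_scaleW.
have tq1 : test_function (fun x => bump c kappa (energy 0 x) * p (sc lam x)).
  apply/test_functionP; split; first by apply: smooth_mul => //; exact: smooth_fun_energy.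
  exists (Num.max 0 (c + 1 + kappa^-1)); first by rewrite le_max lexx.
  by move=> x Ox; rewrite ge_max => /andP[_ cx]; rewrite bump_far // mul0r.
have dO x : O x -> O (dil (lam / mu) x) by exact: dilation_orthant.
apply: (in_generator_ext HS (HA.1 _ tq1)) => x Ox.
  by rewrite -pq ?scaled_gmap_dilation //; exact: dO.
rewrite (abep_generator_energy0_mul sigma k x sb ssc) (abep_generator_scaleW k sigma_gt0 lam x sp).
by rewrite -Aq ?scaled_gmap_dilation //; exact: dO.
Qed.

Lemma feller_dilated f c kappa lam mu t x : 0 < lam -> lam <= mu -> 0 < kappa -> C0 f ->
  0 <= t -> O x ->
  S t (fun y => bump c kappa (energy 0 y) * f (dil (lam / mu) y)) x =
  bump c kappa (energy 0 x) * S t f (dil (lam / mu) x).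
Proof.
move=> l0 lm k0 cf t0 Ox; have m0 := lt_le_trans l0 lm.
have r0 : 0 <= lam / mu by apply: divr_ge0; exact: ltW.
have r1 : lam / mu <= 1 by rewrite ler_pdivrMr // mul1r.
have dO y : O y -> O (dil (lam / mu) y) by exact: dilation_orthant.
apply: (feller_commute HS HA (w := fun y => bump c kappa (energy 0 y))) => //.
- by move=> y _; rewrite ger0_norm ?smooth_step_ge0 ?smooth_step_le1.
- move=> g cg; apply: (@C0_compact_support _ _ _ (c + 1 + kappa^-1)).
    apply: within_orthantM; first exact/within_orthant_fun_energy/bump_continuous.
    apply: within_orthant_comp; [by case: cg| |exact: dO].
    by move=> y _; exact: dilation_continuous.
  by move=> y Oy cy; rewrite bump_far // mul0r.
- by move=> q tq; exact: in_generator_dilated.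
Qed.

Lemma dilation1 x : dil (1 / 1) x = x.
Proof.
rewrite -[RHS]tmap_id; apply: eq_tmap => m.
by rewrite divff ?oner_neq0 // mul1r WfunK.
Qed.

(** The case of equal scales, where the dilation is the identity. *)
Lemma feller_localized f c kappa t x : 0 < kappa -> C0 f -> 0 <= t -> O x ->
  S t (fun y => bump c kappa (energy 0 y) * f y) x = bump c kappa (energy 0 x) * S t f x.
Proof.
move=> k0 cf t0 Ox.
have := @feller_dilated f c kappa 1 1 t x ltr01 (lexx 1) k0 cf t0 Ox.
rewrite dilation1 => <-; congr (S t _ x).
by apply/funext => y; rewrite dilation1.
Qed.

(* The total energy is conserved by [S]. *)
Lemma feller_energy_mul (chi : R -> R) phi psi t x : C0 phi -> C0 psi -> 0 <= t -> O x ->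
  {for energy 0 x, continuous chi} ->
  (forall y, O y -> psi y = chi (energy 0 y) * phi y) ->
  S t psi x = chi (energy 0 x) * S t phi x.
Proof.
move=> cphi cpsi t0 Ox cchi E; set e0 := energy 0 x.
apply/eqP; rewrite -subr_eq0 -normr_eq0 eq_le normr_ge0 andbT.
apply/ler_addgt0Pr => e ep; rewrite add0r.
have [B B0 HB] := C0_bounded cphi.
have [d /= d0 Hd] : \forall u \near e0, `|chi e0 - chi u| <= e / B.
  by move/cvgrPdist_le : cchi; apply; exact: divr_gt0.
pose D := fun y => - chi e0 * phi y + psi y.
have cD : C0 D by exact: C0_lincomb.
have DE y : O y -> D y = (chi (energy 0 y) - chi e0) * phi y.
  by move=> Oy; rewrite /D E //; ring.
(* With this parameter the bump vanishes at distance d or more from the energy of x. *)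
have kp : 0 < (d ^+ 2)^-1 by rewrite invr_gt0 exprn_gt0.
have -> : S t psi x - chi e0 * S t phi x = S t D x.
  by rewrite (feller_lincomb HS (a := - chi e0) (f := phi) (g := psi) (h := D)) // mulNr addrC.
(* The bump is 1 at x, so it can be inserted under S_t; on its support the oscillation of chi is at
   most e / B, making the product uniformly at most e. *)
rewrite -[S t D x]mul1r -(bump_center e0 (d ^+ 2)^-1) -feller_localized //.
apply: (feller_bounded HS) => //.
  apply: (C0_mul cD (B := 1)); first exact/within_orthant_fun_energy/bump_continuous.
  by move=> y _; rewrite ger0_norm ?smooth_step_ge0 ?smooth_step_le1.
move=> y Oy; rewrite DE // normrM [`|_ * phi y|]normrM.
have [far|near] := leP d `|energy 0 y - e0|.
  rewrite bump_eq0 ?normr0 ?mul0r ?(ltW ep) // mulrC ler_pdivlMr ?exprn_gt0 // mul1r.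
  by rewrite -[leRHS]real_normK ?num_real // ler_pXn2r // nnegrE ltW.
rewrite -[leRHS]mul1r; apply: ler_pM => //.
  by rewrite ger0_norm ?smooth_step_ge0 ?smooth_step_le1.
rewrite -(divfK (lt0r_neq0 B0) e); apply: ler_pM => //; last exact: HB.
by rewrite distrC; apply: Hd; rewrite /= distrC.
Qed.

(** The image of [sc lam] is bounded, so f o [sc lam] need not vanish at infinity; the factor rho
    restores this and, depending on the conserved energy, commutes with the semigroup. *)
Definition cut (rho : R -> R) lam f : 'rV[R]_L -> R :=
  fun y => rho (energy 0 y) * f (sc lam y).

Lemma cut_within rho lam f : continuous rho -> 0 <= lam -> C0 f ->
  {within O, continuous (cut rho lam f)}.
Proof.
move=> crho l0 [cf _]; apply: within_orthantM; first exact: within_orthant_fun_energy.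
apply: within_orthant_comp; [exact: cf|by move=> y _; exact: scaled_gmap_continuous|].
by move=> y; exact: scaled_gmap_orthant.
Qed.

Lemma cut_C0 rho K lam f : continuous rho -> (forall e, K <= e -> rho e = 0) ->
  0 <= lam -> C0 f -> C0 (cut rho lam f).
Proof.
move=> crho rhoK l0 cf; apply: (@C0_compact_support _ _ _ K); first exact: cut_within.
by move=> y _ Ky; rewrite /cut rhoK // mul0r.
Qed.

(** x and y represent the same BEP state at scales mu and lam. Cross-multiplying the cutoffs avoids
    division and makes the claim symmetric, so that lam <= mu may be assumed. *)
Lemma feller_scale_invariant (rho1 rho2 : R -> R) K1 K2 f lam mu t x y :
  continuous rho1 -> (forall e, K1 <= e -> rho1 e = 0) ->
  continuous rho2 -> (forall e, K2 <= e -> rho2 e = 0) ->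
  0 < lam -> 0 < mu -> C0 f -> 0 <= t -> O x -> O y -> sc mu x = sc lam y ->
  rho2 (energy 0 y) * S t (cut rho1 mu f) x = rho1 (energy 0 x) * S t (cut rho2 lam f) y.
Proof.
wlog lm : rho1 rho2 K1 K2 lam mu x y / lam <= mu => [WH|].
  move=> c1 H1 c2 H2 l0 m0 cf t0 Ox Oy E; have [lm|/ltW ml] := leP lam mu; first exact: (WH _ _ K1 K2).
  by apply/esym; apply: (WH _ _ K2 K1).
move=> c1 H1 c2 H2 l0 m0 cf t0 Ox Oy E; pose r := lam / mu.
have r0 : 0 <= r by apply: divr_ge0; exact: ltW.
have r1 : r <= 1 by rewrite ler_pdivrMr // mul1r.
have xE : x = dil r y.
  by rewrite -(scaled_gmapK sigma_gt0 x m0) E -(scaled_gmap_dilation sigma_gt0 y l0 lm) scaled_gmapK.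
have cm : C0 (cut rho1 mu f) := cut_C0 c1 H1 (ltW m0) cf.
have cl : C0 (cut rho2 lam f) := cut_C0 c2 H2 (ltW l0) cf.
set c := energy 0 y.
pose J := fun y' => bump c 1 (energy 0 y') * cut rho1 mu f (dil r y').
have SJ : S t J y = S t (cut rho1 mu f) x.
  by rewrite /J (@feller_dilated _ c 1 lam mu) // bump_center mul1r xE.
have cJ : C0 J.
  apply: (@C0_compact_support _ _ _ (c + 1 + 1^-1)).
    apply: within_orthantM; first exact/within_orthant_fun_energy/bump_continuous.
    apply: within_orthant_comp; first by case: cm.
    - by move=> y' _; exact: dilation_continuous.
    - by move=> y'; exact: dilation_orthant.
  by move=> y' Oy' cy; rewrite /J bump_far // mul0r.
have cJ2 : C0 (fun y' => rho2 (energy 0 y') * J y').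
  apply: (@C0_compact_support _ _ _ K2).
    by apply: within_orthantM; [exact: within_orthant_fun_energy|case: cJ].
  by move=> y' Oy' cy; rewrite H2 // mul0r.
rewrite -SJ -(feller_energy_mul cJ cJ2 t0 Oy (c2 _)) //.
(* rho2 J and [cut rho2 lam f] differ by this function of the energy, because [sc mu] after [dil r]
   is [sc lam]. *)
pose chi e := bump c 1 e * rho1 (V (r * W e)).
have -> : rho1 (energy 0 x) = chi (energy 0 y).
  by rewrite /chi bump_center mul1r xE energy_dilation.
apply: feller_energy_mul => //.
  apply: cvgM; first exact: bump_continuous.
  apply: (@continuous_comp _ _ _ (fun e => V (r * W e)) rho1); last exact: c1.
  apply: (@continuous_comp _ _ _ (fun e => r * W e) V); first by apply: cvgMr; exact: Wfun_continuous.
  exact/Vfun_continuous/scale_Wfun_lt.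
move=> y' Oy'; rewrite /J /cut /chi energy_dilation /r scaled_gmap_dilation //; ring.
Qed.

End abep_semigroup.

(** * The semigroup of the BEP *)

Section bep_semigroup.
Context {R : realType} {L : nat} (sigma k : R) (sigma_gt0 : 0 < sigma).
Implicit Types (f h p q : 'rV[R]_L -> R) (x y z : 'rV[R]_L) (s t e lam mu M : R).

Local Notation O := (@orthant R L).
Local Notation W := (Wfun sigma).
Local Notation V := (Vfun sigma).
Local Notation sc := (@scaled_gmap R L sigma).
Local Notation us := (@scaled_ginv R L sigma).
Local Notation ABEP := (@abep_generator R L sigma k).
Local Notation BEP := (@bep_generator R L k).

Context (S : R -> ('rV[R]_L -> R) -> 'rV[R]_L -> R) (HS : feller_semigroup S).
Context (HA : generator_acts_on_core S ABEP).

(** Equal to 1 up to ABEP energy 1, hence invisible at BEP energies up to lam W(1); this is the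
    range in which scale lam is used. *)
Definition unit_cut e : R := smooth_step (e - 1).
Local Notation cut1 := (@cut R L sigma unit_cut).

Lemma unit_cut_continuous : continuous unit_cut.
Proof.
move=> e; apply: (@continuous_comp _ _ _ (fun e : R => e - 1) (@smooth_step R)).
  by apply: cvgB; [exact: cvg_id|exact: cvg_cst].
exact: smooth_step_continuous.
Qed.

Lemma unit_cut1 e : e <= 1 -> unit_cut e = 1.
Proof. by move=> e1; rewrite /unit_cut smooth_step1 // subr_le0. Qed.

Lemma unit_cut0 e : 2 <= e -> unit_cut e = 0.
Proof. by move=> e2; rewrite /unit_cut smooth_step0 //; lra. Qed.

Lemma unit_cut_ge0 e : 0 <= unit_cut e. Proof. exact: smooth_step_ge0. Qed.

Lemma unit_cut_le1 e : unit_cut e <= 1. Proof. exact: smooth_step_le1. Qed.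

Lemma cut1_C0 lam f : 0 < lam -> C0 f -> C0 (cut1 lam f).
Proof. by move=> l0 cf; exact: (cut_C0 sigma_gt0 unit_cut_continuous unit_cut0 (ltW l0) cf). Qed.

Let W1_gt0 : 0 < W 1. Proof. by rewrite -(Wfun0 sigma); exact: Wfun_lt_mono. Qed.

Lemma exists_scale M : exists2 lam, 0 < lam & M <= lam * W 1.
Proof.
exists (1 + `|M| / W 1); first by rewrite ltr_pwDl // divr_ge0 // ltW.
rewrite mulrDl divfK ?gt_eqF // (le_trans (ler_norm M)) // lerDr mul1r ltW //.
Qed.

Section in_range.
Context (lam : R) (z : 'rV[R]_L) (lam_gt0 : 0 < lam) (Oz : O z) (zlam : energy 0 z <= lam * W 1).

Lemma scale_in_range : 2 * sigma * (energy 0 z / lam) < 1.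
Proof.
apply: le_lt_trans (Wfun_lt sigma_gt0 1); rewrite ler_wpM2l ?mulr_ge0 ?(ltW sigma_gt0) //.
by rewrite ler_pdivrMr // mulrC.
Qed.

Lemma in_range_orthant : O (us lam z).
Proof. by apply: scaled_ginv_orthant => //; exact: scale_in_range. Qed.

Lemma in_rangeK : sc lam (us lam z) = z.
Proof. by apply: scaled_ginvK => //; exact: scale_in_range. Qed.

Lemma in_range_cut1 : unit_cut (energy 0 (us lam z)) = 1.
Proof.
apply: unit_cut1; rewrite energy_scaled_ginv -(WfunK sigma_gt0 1).
by apply: Vfun_le; rewrite ?Wfun_lt // ler_pdivrMr // mulrC.
Qed.

End in_range.

(** The summand 1 keeps the scale positive at z = 0. *)
Definition bep_scale z : R := 1 + energy 0 z / W 1.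

Lemma bep_scale_gt0 z : O z -> 0 < bep_scale z.
Proof. by move=> Oz; rewrite ltr_pwDl // divr_ge0 ?(ltW W1_gt0) // orthant_energy_ge0. Qed.

Lemma bep_scale_range z : energy 0 z <= bep_scale z * W 1.
Proof. by rewrite mulrDl divfK ?gt_eqF // lerDr mul1r ltW. Qed.

(* As [gmap sigma] only reaches the states of total energy less than [1 / (2 sigma)], a state
   is first rescaled; the BEP conserves the energy and commutes with dilations. *)
Definition bep_semigroup t f z : R :=
  S t (cut1 (bep_scale z) f) (us (bep_scale z) z).

Local Notation T := bep_semigroup.

Lemma cut_bep_semigroup (rho : R -> R) K lam t f y : continuous rho ->
  (forall e, K <= e -> rho e = 0) -> 0 < lam -> C0 f -> 0 <= t -> O y ->
  S t (cut sigma rho lam f) y = rho (energy 0 y) * T t f (sc lam y).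
Proof.
move=> crho rhoK l0 cf t0 Oy; have Oz := scaled_gmap_orthant sigma_gt0 (ltW l0) Oy.
set z := sc lam y in Oz *; have m0 := bep_scale_gt0 Oz.
have zr := bep_scale_range z; set mu := bep_scale z in m0 zr.
have := feller_scale_invariant sigma_gt0 HS HA unit_cut_continuous unit_cut0 crho rhoK l0 m0 cf
  t0 (in_range_orthant m0 Oz zr) Oy (in_rangeK m0 Oz zr).
by rewrite in_range_cut1 // mul1r => <-.
Qed.

Lemma cut1_bep_semigroup lam t f y : 0 < lam -> C0 f -> 0 <= t -> O y ->
  S t (cut1 lam f) y = cut1 lam (T t f) y.
Proof.
by move=> l0 cf t0 Oy; rewrite (cut_bep_semigroup unit_cut_continuous unit_cut0).
Qed.

(** Continuity and uniform estimates need a scale that does not vary with z. *)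
Lemma bep_semigroupE lam t f z : 0 < lam -> C0 f -> 0 <= t -> O z -> energy 0 z <= lam * W 1 ->
  T t f z = S t (cut1 lam f) (us lam z).
Proof.
move=> l0 cf t0 Oz zl.
have Ox := in_range_orthant l0 Oz zl.
by rewrite cut1_bep_semigroup // /cut in_range_cut1 // mul1r in_rangeK.
Qed.

Lemma cut1_ginv lam f z : 0 < lam -> O z -> energy 0 z <= lam * W 1 ->
  cut1 lam f (us lam z) = f z.
Proof. by move=> l0 Oz zl; rewrite /cut in_range_cut1 // mul1r in_rangeK. Qed.

Lemma cut1_bounded lam f C : 0 < lam -> bounded_by C f -> bounded_by C (cut1 lam f).
Proof.
move=> l0 fC y Oy; rewrite normrM -[leRHS]mul1r; apply: ler_pM => //.
  by rewrite ger0_norm ?unit_cut_ge0 ?unit_cut_le1.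
by apply: fC; exact: scaled_gmap_orthant (ltW l0) Oy.
Qed.

Lemma within_orthant_lift (F : 'rV[R]_L -> R) :
  (forall M, exists lam phi, [/\ 0 < lam, M <= lam * W 1, C0 phi &
     forall z, O z -> energy 0 z <= lam * W 1 -> F z = phi (us lam z)]) ->
  {within O, continuous F}.
Proof.
move=> H; apply/within_orthantP => z Oz e e0.
have [lam [phi [l0 zl [/within_orthantP cphi _] E]]] := H (energy 0 z + 1).
have zl' : energy 0 z <= lam * W 1 by apply: le_trans zl; rewrite lerDl.
have K : \forall y \near z, O (us lam y) -> `|phi (us lam z) - phi (us lam y)| <= e.
  have H1 := cphi _ (in_range_orthant l0 Oz zl') e e0.
  exact: (scaled_ginv_continuous sigma_gt0 l0 (scale_in_range l0 zl') Oz H1).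
near=> y => Oy.
have yl : energy 0 y <= lam * W 1.
  apply: le_trans zl; near: y.
  by apply: (cvgr_le (energy 0 z)); [exact: energy_continuous|rewrite ltrDl].
rewrite !E //; have Ou := in_range_orthant l0 Oy yl.
by move: Ou; near: y.
Unshelve. all: by end_near. Qed.

Lemma bep_semigroup_energy_mul (chi : R -> R) f h t z : C0 f -> C0 h -> 0 <= t -> O z ->
  continuous chi -> (forall y, O y -> h y = chi (energy 0 y) * f y) ->
  T t h z = chi (energy 0 z) * T t f z.
Proof.
move=> cf ch t0 Oz cchi E; have l0 := bep_scale_gt0 Oz; have zl := bep_scale_range z.
rewrite /T; set lam := bep_scale z in l0 zl *.
have Ox := in_range_orthant l0 Oz zl.
rewrite -{2}(in_rangeK l0 Oz zl) energy_scaled_gmap.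
apply: (feller_energy_mul sigma_gt0 HS HA (chi := fun e => chi (lam * W e))) => //.
- exact: cut1_C0.
- exact: cut1_C0.
- apply: (@continuous_comp _ _ _ (fun e => lam * W e) chi); last exact: cchi.
  by apply: cvgMr; exact: Wfun_continuous.
- move=> y Oy; rewrite /cut E ?energy_scaled_gmap 1?mulrCA //.
  exact: scaled_gmap_orthant (ltW l0) Oy.
Qed.

Lemma bep_semigroup_bounded t f C : 0 <= t -> C0 f -> bounded_by C f -> bounded_by C (T t f).
Proof.
move=> t0 cf fC z Oz; have l0 := bep_scale_gt0 Oz.
apply: (feller_bounded HS) => //; [exact: cut1_C0|exact: cut1_bounded|].
exact: in_range_orthant (bep_scale_range z).
Qed.

(** By conservation, f may be multiplied by a function of the energy that is 0 up to M and 1 from M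
    + 1 on, without changing T_t f above M + 1. *)
Lemma bep_semigroup_far t f e M : 0 <= t -> C0 f -> 0 <= e ->
  (forall z, O z -> M <= energy 0 z -> `|f z| <= e) ->
  forall z, O z -> M + 1 <= energy 0 z -> `|T t f z| <= e.
Proof.
move=> t0 cf e0 fM z Oz Mz; pose chi u : R := 1 - smooth_step (u - M).
have cchi : continuous chi.
  move=> u; apply: cvgB; first exact: cvg_cst.
  apply: (@continuous_comp _ _ _ (fun u : R => u - M) (@smooth_step R)).
    by apply: cvgB; [exact: cvg_id|exact: cvg_cst].
  exact: smooth_step_continuous.
have chi1 u : `|chi u| <= 1.
  by rewrite /chi ger0_norm ?subr_ge0 ?smooth_step_le1 // gerBl smooth_step_ge0.
have ch : C0 (fun y => chi (energy 0 y) * f y).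
  by apply: (C0_mul cf (B := 1)); [exact: within_orthant_fun_energy|move=> y _].
have : `|T t (fun y => chi (energy 0 y) * f y) z| <= e.
  apply: bep_semigroup_bounded => // y Oy.
  have [yM|My] := leP (energy 0 y) M.
    by rewrite /chi smooth_step1 ?subr_le0 // subrr mul0r normr0.
  by rewrite normrM -[leRHS]mul1r; apply: ler_pM => //; exact/fM/ltW.
rewrite (bep_semigroup_energy_mul cf ch t0 Oz cchi) // /chi smooth_step0 ?subr0 ?mul1r //.
by rewrite lerBrDl.
Qed.

Lemma bep_semigroup_C0 t f : 0 <= t -> C0 f -> C0 (T t f).
Proof.
move=> t0 cf; split.
  apply: within_orthant_lift => M; have [lam l0 Ml] := exists_scale M.
  exists lam, (S t (cut1 lam f)); split=> //; first exact/(feller_C0 HS)/cut1_C0.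
  by move=> z Oz zl; exact: bep_semigroupE.
move=> e e0; have [M HM] := C0_small cf (divr_gt0 e0 (ltr0Sn _ 1)).
exists (M + 1) => z Oz Mz; apply: (@le_lt_trans _ _ (e / 2)); last by lra.
apply: (bep_semigroup_far t0 cf _ HM) => //; first by rewrite divr_ge0 // ltW.
by apply: le_trans (orthant_norm_le Oz); exact: ltW.
Qed.

Lemma bep_semigroup_conservative t z e : 0 <= t -> O z -> 0 < e ->
  exists f, [/\ C0 f, (forall y, O y -> 0 <= f y <= 1) & 1 - e < T t f z].
Proof.
move=> t0 Oz e0; have l0 := bep_scale_gt0 Oz; have zl := bep_scale_range z.
pose chi u : R := smooth_step (u - energy 0 z).
have cchi : continuous chi.
  move=> u; apply: (@continuous_comp _ _ _ (fun u : R => u - energy 0 z) (@smooth_step R)).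
    by apply: cvgB; [exact: cvg_id|exact: cvg_cst].
  exact: smooth_step_continuous.
have cf : C0 (fun y : 'rV[R]_L => chi (energy 0 y)).
  apply: (@C0_compact_support _ _ _ (energy 0 z + 1)); first exact: within_orthant_fun_energy.
  by move=> y _ yz; rewrite /chi smooth_step0 // lerBrDl.
exists (fun y => chi (energy 0 y)); split=> //.
  by move=> y _; rewrite smooth_step_ge0 smooth_step_le1.
rewrite /T; set lam := bep_scale z in l0 zl *; have Ox := in_range_orthant l0 Oz zl.
have [phi [cphi phi01 Hphi]] := feller_conservative HS t0 Ox e0.
(* The chosen f becomes rho(energy) after cutting; it dominates rho phi, and S_t (rho phi) equals
   S_t phi at the point, where rho is 1. *)
pose rho u := unit_cut u * chi (lam * W u).
have crho : continuous rho.
  move=> u; apply: cvgM; first exact: unit_cut_continuous.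
  apply: (@continuous_comp _ _ _ (fun e => lam * W e) chi); last exact: cchi.
  by apply: cvgMr; exact: Wfun_continuous.
have rho01 u : 0 <= rho u <= 1.
  by rewrite mulr_ge0 ?unit_cut_ge0 ?smooth_step_ge0 //= mulr_ile1 ?unit_cut_ge0 ?unit_cut_le1
     ?smooth_step_ge0 ?smooth_step_le1.
have cpsi : C0 (fun y => rho (energy 0 y) * phi y).
  apply: (C0_mul cphi (B := 1)); first exact: within_orthant_fun_energy.
  by move=> y _; have /andP[r0 r1] := rho01 (energy 0 y); rewrite ger0_norm.
apply: (lt_le_trans Hphi).
have rho1 : rho (energy 0 (us lam z)) = 1.
  rewrite /rho in_range_cut1 // mul1r -energy_scaled_gmap in_rangeK // /chi subrr.
  exact: smooth_step1.
rewrite -[S t phi _]mul1r -rho1.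
rewrite -(feller_energy_mul sigma_gt0 HS HA cphi cpsi t0 Ox (crho _)) //.
apply: (feller_mono HS) => //; first exact: cut1_C0.
move=> y Oy; rewrite /cut energy_scaled_gmap -/(rho (energy 0 y)).
have /andP[r0 _] := rho01 (energy 0 y); have /andP[_ p1] := phi01 y Oy.
by rewrite -[leRHS]mulr1 ler_wpM2l.
Qed.

Lemma bep_semigroup_strong f e : C0 f -> 0 < e ->
  \forall t \near 0^'+, forall z, O z -> `|T t f z - f z| <= e.
Proof.
move=> cf e0; have [M HM] := C0_small cf (divr_gt0 e0 (ltr0Sn _ 1)).
have [lam l0 Ml] := exists_scale (M + 1).
have [d d0 Hd] := feller_strong HS (cut1_C0 l0 cf) e0.
apply/near_right0P; exists d => // t t0 td z Oz; have t0' := ltW t0.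
have [zM|Mz] := leP (energy 0 z) (M + 1).
  have zl := le_trans zM Ml.
  rewrite (bep_semigroupE l0) // -(cut1_ginv f l0 Oz zl).
  exact: Hd (in_range_orthant l0 Oz zl).
apply: (le_trans (ler_normB _ _)); rewrite [leRHS]splitr lerD //.
  by apply: (bep_semigroup_far t0' cf _ HM) => //; [rewrite divr_ge0 // ltW|exact: ltW].
by apply: HM => //; apply: (le_trans _ (ltW Mz)); rewrite lerDl.
Qed.

Lemma bep_semigroup_feller : feller_semigroup T.
Proof.
split.
- exact: bep_semigroup_C0.
- move=> t a f h z t0 cf ch Oz; have l0 := bep_scale_gt0 Oz.
  apply: (feller_lincomb HS) => //; try exact: cut1_C0.
    by move=> y Oy; rewrite /cut; ring.
  exact: in_range_orthant (bep_scale_range z).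
- move=> t f t0 cf f01 z Oz; have l0 := bep_scale_gt0 Oz.
  apply: (feller_contraction HS) => //; first exact: cut1_C0.
    move=> y Oy; have /andP[f0 f1] := f01 _ (scaled_gmap_orthant sigma_gt0 (ltW l0) Oy).
    by rewrite /cut mulr_ge0 ?unit_cut_ge0 //= mulr_ile1 ?unit_cut_ge0 ?unit_cut_le1.
  exact: in_range_orthant (bep_scale_range z).
- exact: bep_semigroup_conservative.
- move=> f z cf Oz; have l0 := bep_scale_gt0 Oz.
  rewrite /T (feller_0 HS) ?cut1_ginv ?bep_scale_range //; first exact: cut1_C0.
  exact: in_range_orthant (bep_scale_range z).
- move=> s t f z s0 t0 cf Oz; have l0 := bep_scale_gt0 Oz.
  have Ox := in_range_orthant l0 Oz (bep_scale_range z).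
  have cc := cut1_C0 l0 cf.
  (* The scale attached to z serves both steps, since S_t of a cut function is the cut of T_t f. *)
  rewrite /T (feller_D HS) //; apply: (feller_ext HS) => //; first exact: (feller_C0 HS).
  by move=> y Oy; exact: cut1_bep_semigroup.
- exact: bep_semigroup_strong.
Qed.

(** Covers z on the boundary of the orthant: by conservation of energy the pullback of f has S_t
    equal to 0 at the point over z for every t, hence zero derivative in t. *)
Lemma bep_generator_eq0 f z M : smooth f -> (forall y, O y -> M <= energy 0 y -> f y = 0) ->
  O z -> M < energy 0 z -> BEP f z = 0.
Proof.
move=> sf fM Oz Mz; have [lam l0 zl] := exists_scale (energy 0 z).
have Ox := in_range_orthant l0 Oz zl.
have Ml : 2 * sigma * (M / lam) < 1.
  apply: le_lt_trans (scale_in_range l0 zl); rewrite ler_wpM2l ?mulr_ge0 ?(ltW sigma_gt0) //.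
  by rewrite ler_wpM2r ?invr_ge0 ?(ltW l0) // ltW.
have /in_generatorP[cq _ Gq] := in_generator_scaled sigma_gt0 HS HA l0 sf Ml fM.
have dM : 0 < energy 0 z - M by rewrite subr_gt0.
pose chi u : R := smooth_step ((lam * W u - M) / (energy 0 z - M)).
have cchi : continuous chi.
  move=> u; apply: (@continuous_comp _ _ _ (fun u => (lam * W u - M) / (energy 0 z - M)) (@smooth_step R)).
    apply: cvgMl; apply: cvgB; last exact: cvg_cst.
    by apply: cvgMr; exact: Wfun_continuous.
  exact: smooth_step_continuous.
have Sq t : 0 <= t -> S t (fun x => f (sc lam x)) (us lam z) = 0.
  move=> t0; rewrite (feller_energy_mul sigma_gt0 HS HA cq cq t0 Ox (cchi _)).
    rewrite /chi -energy_scaled_gmap in_rangeK // divff ?gt_eqF // smooth_step0 ?mul0r //.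
  move=> y Oy; have [yM|My] := leP (energy 0 (sc lam y)) M.
    rewrite /chi -energy_scaled_gmap smooth_step1 ?mul1r //.
    by rewrite pmulr_lle0 ?invr_gt0 // subr_le0.
  rewrite fM ?mulr0 ?(ltW My) //; exact: scaled_gmap_orthant (ltW l0) Oy.
apply/eqP; rewrite -normr_eq0 eq_le normr_ge0 andbT; apply/ler_addgt0Pr => e e0; rewrite add0r.
have [d d0 Hd] := Gq e e0.
have t0 : 0 < d / 2 by rewrite divr_gt0.
have td : d / 2 < d by lra.
have := Hd _ t0 td _ Ox; rewrite Sq ?(ltW t0) // in_rangeK // fM ?(ltW Mz) //.
by rewrite subrr add0r normrN normrM gtr0_norm // mulrC ler_pM2r.
Qed.

Lemma bep_generator_core f : test_function f -> in_generator T f (BEP f).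
Proof.
move=> tf; have /test_functionP[sf [M M0 fM]] := tf.
have cf : C0 f.
  apply: (@C0_compact_support _ _ _ M) => //.
  by apply: continuous_subspaceT => x; exact/differentiable_continuous/smooth_differentiable.
have Mrange lam : 0 < lam -> M <= lam * W 1 -> 2 * sigma * (M / lam) < 1.
  move=> l0 Ml; apply: le_lt_trans (Wfun_lt sigma_gt0 1).
  by rewrite ler_wpM2l ?mulr_ge0 ?(ltW sigma_gt0) // ler_pdivrMr // mulrC.
have cB : C0 (BEP f).
  apply: (@C0_compact_support _ _ _ (M + 1)).
    (* The scale must exceed M, to make the pullback of f a test function, and M', to cover the
       requested energies. *)
    apply: within_orthant_lift => M'; have [lam l0 Ml] := exists_scale (Num.max M M').
    move: Ml; rewrite ge_max => /andP[Ml M'l].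
    have [_ cq _] := in_generator_scaled sigma_gt0 HS HA l0 sf (Mrange _ l0 Ml) fM.
    exists lam, (fun x => BEP f (sc lam x)); split; [exact: l0|exact: M'l|exact: cq|].
    by move=> z Oz zl; rewrite in_rangeK.
  by move=> z Oz Mz; apply: (bep_generator_eq0 sf fM Oz); apply: lt_le_trans Mz; rewrite ltrDl.
apply/in_generatorP; split=> // e e0.
have [lam l0 Ml] := exists_scale (M + 1).
have Ml' : M <= lam * W 1 by apply: le_trans Ml; rewrite lerDl.
have /in_generatorP[cq _ Gq] := in_generator_scaled sigma_gt0 HS HA l0 sf (Mrange _ l0 Ml') fM.
have cutE y : O y -> cut1 lam f y = f (sc lam y).
  move=> Oy; have Osc := scaled_gmap_orthant sigma_gt0 (ltW l0) Oy.
  have [y1|y1] := leP (energy 0 y) 1; first by rewrite /cut unit_cut1 // mul1r.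
  rewrite /cut fM ?mulr0 // energy_scaled_gmap (le_trans Ml') // ler_wpM2l ?(ltW l0) //.
  by apply: Wfun_le => //; exact: ltW.
have [d d0 Hd] := Gq e e0; exists d; first exact: d0.
move=> t t0 td z Oz; have t0' := ltW t0.
have [zM|Mz] := leP (energy 0 z) (M + 1).
  have zl := le_trans zM Ml; have Ox := in_range_orthant l0 Oz zl.
  have := Hd t t0 td _ Ox; rewrite in_rangeK //.
  by rewrite (bep_semigroupE l0) // (feller_ext HS t0' (cut1_C0 l0 cf) cutE).
have Mz' : M < energy 0 z by apply: lt_trans Mz; rewrite ltrDl.
have /eqP : `|T t f z| == 0.
  rewrite eq_le normr_ge0 andbT; apply: (bep_semigroup_far t0' cf (lexx 0)) (ltW Mz) => //.
  by move=> y Oy My; rewrite fM // normr0.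
move/normr0_eq0 => ->; rewrite (fM z Oz (ltW Mz')) (bep_generator_eq0 sf fM) //.
by rewrite mulr0 !subrr normr0 mulr_ge0 ?(ltW e0).
Qed.

Lemma bep_core f h e : in_generator T f h -> 0 < e -> exists p, [/\ test_function p,
  (forall x, O x -> `|p x - f x| <= e) & (forall x, O x -> `|BEP p x - h x| <= e)].
Proof.
move=> /in_generatorP[cf ch Gfh] e0.
have e2 : 0 < e / 2 by rewrite divr_gt0.
have [Mf HMf] := C0_small cf e2; have [Mh HMh] := C0_small ch e2.
have [lam l0] := exists_scale (Num.max Mf Mh); rewrite ge_max => /andP[Mfl Mhl].
(* Cutting at scale lam carries T_t to S_t and has norm at most 1, so it maps the domain of the BEP
   generator into that of the ABEP. *)
have G : in_generator S (cut1 lam f) (cut1 lam h).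
  apply/in_generatorP; split; try exact: cut1_C0.
  move=> e1 /Gfh[d d0 Hd]; exists d => // t t0 td y Oy.
  rewrite cut1_bep_semigroup ?(ltW t0) // /cut mulrCA -!mulrBr.
  rewrite normrM -[leRHS]mul1r; apply: ler_pM => //.
    by rewrite ger0_norm ?unit_cut_ge0 ?unit_cut_le1.
  exact: Hd (scaled_gmap_orthant sigma_gt0 (ltW l0) Oy).
have [q [tq qf qh]] := HA.2 _ _ G _ e2.
have [p [M [tp Ml pM pq]]] := test_function_pullback sigma_gt0 l0 tq.
have [sp _] := tp.
have Bq := bep_generator_scaled sigma_gt0 HS HA l0 sp Ml pM tq pq.
have big z : lam * W 1 <= energy 0 z -> O z -> `|f z| <= e / 2 /\ `|h z| <= e / 2.
  by move=> zl Oz; split; [apply: HMf|apply: HMh] => //; apply: le_trans zl.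
(* Where the cutoff differs from 1 the energy exceeds lam W(1), and there f and h are at most e / 2
   by the choice of lam. *)
have near1 u z : energy 0 z = lam * W u -> O z ->
    `|unit_cut u * f z - f z| <= e / 2 /\ `|unit_cut u * h z - h z| <= e / 2.
  move=> zu Oz; have [u1|u1] := leP u 1.
    by rewrite unit_cut1 // !mul1r !subrr normr0 ltW.
  have [|Hf Hh] := big z _ Oz.
    by rewrite zu ler_wpM2l ?(ltW l0) // Wfun_le // ltW.
  have c1 : `|unit_cut u - 1| <= 1.
    by rewrite distrC ger0_norm ?subr_ge0 ?unit_cut_le1 // gerBl unit_cut_ge0.
  have E a : unit_cut u * a - a = (unit_cut u - 1) * a by ring.
  by rewrite !E !normrM -[e / 2]mul1r; split; apply: ler_pM.
exists p; split=> // z Oz; have [zl|lz] := ltP (2 * sigma * (energy 0 z / lam)) 1.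
- have Ox := scaled_ginv_orthant sigma_gt0 l0 zl Oz.
  have xK := scaled_ginvK sigma_gt0 l0 zl Oz.
  have [|H _] := near1 (energy 0 (us lam z)) z _ Oz; first by rewrite -energy_scaled_gmap xK.
  have := qf _ Ox; rewrite -pq // /cut xK => H'.
  by rewrite -(subrKA (unit_cut (energy 0 (us lam z)) * f z)) (le_trans (ler_normD _ _)) // [leRHS]splitr lerD.
(* Such z lie outside the image of [sc lam], where p vanishes and f is small. *)
- have zM : M <= energy 0 z.
    rewrite -(@ler_pM2r _ lam^-1) ?invr_gt0 // -(@ler_pM2l _ (2 * sigma)) ?mulr_gt0 //.
    exact: le_trans (ltW Ml) lz.
  rewrite pM // sub0r normrN; apply: (@le_trans _ _ (e / 2)); last lra.
  apply: (proj1 (big z _ Oz)).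
  rewrite mulrC -ler_pdivlMr // -(@ler_pM2l _ (2 * sigma)) ?mulr_gt0 //.
  exact: le_trans (ltW (Wfun_lt sigma_gt0 1)) lz.
- have Ox := scaled_ginv_orthant sigma_gt0 l0 zl Oz.
  have xK := scaled_ginvK sigma_gt0 l0 zl Oz.
  have [|_ H] := near1 (energy 0 (us lam z)) z _ Oz; first by rewrite -energy_scaled_gmap xK.
  have := qh _ Ox; rewrite -Bq // /cut xK => H'.
  by rewrite -(subrKA (unit_cut (energy 0 (us lam z)) * h z)) (le_trans (ler_normD _ _)) // [leRHS]splitr lerD.
- have zM : M < energy 0 z.
    rewrite -(@ltr_pM2r _ lam^-1) ?invr_gt0 // -(@ltr_pM2l _ (2 * sigma)) ?mulr_gt0 //.
    exact: lt_le_trans Ml lz.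
  rewrite (bep_generator_eq0 sp pM Oz zM) sub0r normrN; apply: (@le_trans _ _ (e / 2)); last lra.
  apply: (proj2 (big z _ Oz)).
  rewrite mulrC -ler_pdivlMr // -(@ler_pM2l _ (2 * sigma)) ?mulr_gt0 //.
  exact: le_trans (ltW (Wfun_lt sigma_gt0 1)) lz.
Qed.

Lemma bep_generator_acts_on_core : generator_acts_on_core T BEP.
Proof. by split; [exact: bep_generator_core|move=> f h G e; exact: bep_core]. Qed.

End bep_semigroup.

(** * The transformed process *)

Section measurability.
Context {R : realType} {L : nat} {d : measure_display} {U : measurableType d}.
Context (X : U -> 'rV[R]_L).
Context (mX : forall i, measurable_fun setT (fun w => X w ord0 i)).

Lemma measurable_energy m : measurable_fun setT (fun w => energy m (X w)).
Proof.
rewrite (_ : (fun w => _) =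
  fun w => \sum_(l <- index_enum 'I_L) (if (m <= l)%N then X w ord0 l else 0)); last first.
  by apply/funext => w; rewrite /energy big_mkcond.
apply: measurable_sum => l; case: (m <= l)%N; [exact: mX|exact: measurable_cst].
Qed.

Lemma measurable_tmap (h : R -> R) i : continuous h ->
  measurable_fun setT (fun w => tmap h (X w) ord0 i).
Proof.
move=> ch; rewrite (_ : (fun w => _) =
  (fun w => h (energy i (X w)) - h (energy i.+1 (X w)))); last first.
  by apply/funext => w; rewrite mxE.
have mh : measurable_fun setT h by exact: continuous_measurable_fun.
by apply: measurable_funB; apply: (measurableT_comp mh); exact: measurable_energy.
Qed.

(* [f o X] is the limit of the countably valued functions obtained by rounding the coordinates
   of [X] down to multiples of [1 / (n + 1)]. *)
Lemma measurable_comp_orthant (f : 'rV[R]_L -> R) : (forall w, orthant (X w)) ->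
  {within @orthant R L, continuous f} -> measurable_fun setT (fun w => f (X w)).
Proof.
move=> OX /within_orthantP cf.
pose N n w : 'rV[nat]_L := \row_i Num.truncn (n.+1%:R * X w ord0 i).
pose g n (v : 'rV[nat]_L) : 'rV[R]_L := \row_i ((v ord0 i)%:R / n.+1%:R).
have n0 n : 0 < n.+1%:R :> R by rewrite ltr0n.
have Og n v : orthant (g n v) by move=> i; rewrite mxE divr_ge0.
have gX n w : `|X w - g n (N n w)| <= n.+1%:R^-1.
  rewrite /Num.Def.normr/= mx_normrE; apply: bigmax_le => /=; first by rewrite invr_ge0.
  move=> [j i] _ /=; rewrite !mxE (ord1 j).
  have /andP[H1 H2] : (Num.truncn (n.+1%:R * X w ord0 i))%:R <= n.+1%:R * X w ord0 i
      < (Num.truncn (n.+1%:R * X w ord0 i)).+1%:R.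
    by apply: truncn_itv; rewrite mulr_ge0 // OX.
  have -> : X w ord0 i - (Num.truncn (n.+1%:R * X w ord0 i))%:R / n.+1%:R =
     (n.+1%:R * X w ord0 i - (Num.truncn (n.+1%:R * X w ord0 i))%:R) / n.+1%:R.
    by rewrite mulrBl mulrAC divff ?mul1r // gt_eqF.
  rewrite normrM normfV (gtr0_norm (n0 n)) ger0_norm ?subr_ge0 //.
  rewrite -[leRHS]mul1r ler_wpM2r ?invr_ge0 //.
  by rewrite lerBlDl natr1; exact: ltW.
apply: (@measurable_fun_cvg _ _ _ setT (fun n w => f (g n (N n w)))).
  move=> n _ B mB; rewrite setTI.
  (* The rounded value is constant on each of countably many grid cells, and a cell is described by
     the coordinates of X. *)
  have -> : (fun w => f (g n (N n w))) @^-1` B =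
      \bigcup_(v : 'rV[nat]_L) ([set w | B (f (g n v))] `&` \bigcap_(i in [set: 'I_L])
        (fun w => X w ord0 i) @^-1` `[(v ord0 i)%:R / n.+1%:R, (v ord0 i).+1%:R / n.+1%:R[).
    apply/seteqP; split=> [w /= Bw|w [v _ [/= Bv Hv]]].
      exists (N n w) => //; split => //= i _; rewrite /= in_itv /= mxE.
      rewrite ler_pdivrMr // ltr_pdivlMr // mulrC.
      by apply: truncn_itv; rewrite mulr_ge0 // OX.
    rewrite (_ : N n w = v) //; apply/rowP => i; rewrite mxE; apply: truncn_def.
    by have := Hv i I; rewrite /= in_itv /= ler_pdivrMr // ltr_pdivlMr // mulrC.
  apply: countable_bigcupT_measurable; first exact: countableP.
  move=> v; apply: measurableI.
    have [Bv|nBv] := pselect (B (f (g n v))).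
      by rewrite (_ : [set _ | _] = setT) //; apply/seteqP; split.
    by rewrite (_ : [set _ | _] = set0) //; apply/seteqP; split.
  apply: fin_bigcap_measurable; first exact: finite_finset.
  by move=> i _; rewrite -[X in measurable X]setTI; apply: mX => //; exact: measurable_itv.
move=> w _; apply/cvgrPdist_le => e e0.
have /nbhs_normP[r /= r0 Hr] := cf _ (OX w) e e0.
near=> n; apply: Hr; last exact: Og.
rewrite /=; apply: le_lt_trans (gX n w) _.
by near: n; exact: near_infty_natSinv_lt (PosNum r0).
Unshelve. all: by end_near. Qed.

End measurability.

Section transformed_process.
Context {R : realType} {L : nat} (sigma k : R) (sigma_gt0 : 0 < sigma).
Context {d : measure_display} {Omega : measurableType d} (P : probability Omega R).
Implicit Types (f : 'rV[R]_L -> R) (x : 'rV[R]_L) (s t : R).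

Local Notation W := (Wfun sigma).
Local Notation sc := (@scaled_gmap R L sigma).

Lemma gmap_scaled x : gmap sigma x = sc 1 x.
Proof. by rewrite gmapE; apply: eq_tmap => m; rewrite mul1r. Qed.

Section sequence_of_cuts.
Context (Y : Omega -> 'rV[R]_L) (C : set Omega) (mC : measurable C).
Context (mY : forall i, measurable_fun setT (fun w => Y w ord0 i)).
Context (OY : forall w, orthant (Y w)).

Definition far_cut (n : nat) (e : R) : R := smooth_step (e - n%:R).

Lemma far_cut_continuous n : continuous (far_cut n).
Proof.
move=> e; apply: (@continuous_comp _ _ _ (fun e : R => e - n%:R) (@smooth_step R)).
  by apply: cvgB; [exact: cvg_id|exact: cvg_cst].
exact: smooth_step_continuous.
Qed.

Lemma far_cut0 n e : n%:R + 1 <= e -> far_cut n e = 0.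
Proof. by move=> ne; rewrite /far_cut smooth_step0 // lerBrDl. Qed.

(** Dominated convergence: at each outcome the cutoff is eventually 1, and a bound of f dominates on
    a probability space. *)
Lemma integral_far_cut f : C0 f ->
  ((\int[P]_(w in C) (cut sigma (far_cut n) 1 f (Y w))%:E)%E @[n --> \oo] -->
   (\int[P]_(w in C) (f (gmap sigma (Y w)))%:E)%E).
Proof.
move=> cf; have [B B0 HB] := C0_bounded cf.
have Osc w : orthant (sc 1 (Y w)) by exact: scaled_gmap_orthant.
apply: (@dominated_cvg _ _ _ P C mC _ _ (EFin \o cst B)).
- move=> n; apply/measurable_EFinP; apply: measurable_funTS.
  by apply: (measurable_comp_orthant mY OY); exact: (cut_within sigma_gt0 (@far_cut_continuous n) ler01 cf).
- move=> w _; apply: cvg_near_cst; near=> n; congr EFin.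
  rewrite /cut gmap_scaled /far_cut smooth_step1 ?mul1r // subr_le0.
  by near: n; exact: nbhs_infty_ger.
- by [].
- exact: finite_measure_integrable_cst.
- move=> n w _; rewrite lee_fin normrM -[leRHS]mul1r; apply: ler_pM => //; last exact: HB.
  by rewrite ger0_norm ?smooth_step_ge0 ?smooth_step_le1.
Unshelve. all: by end_near. Qed.

End sequence_of_cuts.

Context (X : R -> Omega -> 'rV[R]_L).
Context (mX : forall t (i : 'I_L), 0 <= t -> measurable_fun setT (fun w => X t w ord0 i)).

Lemma natural_filtration_measurable s C : natural_filtration X s C -> measurable C.
Proof.
apply: smallest_sub; first exact: sigma_algebra_measurable.
move=> _ [u [i [B [/andP[u0 us] mB ->]]]].
by rewrite -[X in measurable X]setTI; exact: mX.
Qed.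

Lemma natural_filtration_gmap s :
  natural_filtration (fun t w => gmap sigma (X t w)) s `<=` natural_filtration X s.
Proof.
apply: smallest_sub; first exact: smallest_sigma_algebra.
move=> _ [u [i [B [u0s mB ->]]]].
pose G := [set C | exists (u : R) (i : 'I_L) (B : set R), [/\ 0 <= u <= s, measurable B &
  C = (fun w => X u w ord0 i) @^-1` B]].
(* With the past of X taken as the ambient sigma-algebra, the measurability of [tmap] applies
   verbatim. *)
pose Xu : g_sigma_algebraType G -> 'rV[R]_L := X u.
have mXu j : measurable_fun setT (fun w => Xu w ord0 j).
  move=> _ B' mB'; rewrite setTI; apply: sub_sigma_algebra.
  by exists u, j, B'.
have := measurable_tmap mXu i (@Wfun_continuous R sigma) measurableT mB.
rewrite setTI; congr (measurable _).
by apply/funext => w; rewrite /= gmapE.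
Qed.

Context (OX : forall t w, 0 <= t -> orthant (X t w)).
Context (S : R -> ('rV[R]_L -> R) -> 'rV[R]_L -> R) (HS : feller_semigroup S).
Context (HA : generator_acts_on_core S (@abep_generator R L sigma k)).
Context (HX : markov_property P S X).

(** [cut_bep_semigroup] moves the cutoff through S_t unchanged, so the two sides agree for every n
    and share their limit. *)
Lemma markov_property_gmap :
  markov_property P (bep_semigroup sigma S) (fun t w => gmap sigma (X t w)).
Proof.
move=> s t f C s0 t0 cf /natural_filtration_gmap FC.
have mC := natural_filtration_measurable FC.
have st0 : 0 <= s + t by rewrite addr_ge0.
have H1 := integral_far_cut mC (fun i => mX i st0) (fun w => OX w st0) cf.
have cT := bep_semigroup_C0 sigma_gt0 HS HA t0 cf.
have H2 := integral_far_cut mC (fun i => mX i s0) (fun w => OX w s0) cT.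
have E n : (\int[P]_(w in C) (cut sigma (far_cut n) 1 f (X (s + t) w))%:E =
   \int[P]_(w in C) (cut sigma (far_cut n) 1 (bep_semigroup sigma S t f) (X s w))%:E)%E.
  have cc : C0 (cut sigma (far_cut n) 1 f : 'rV[R]_L -> R).
    exact: (cut_C0 sigma_gt0 (@far_cut_continuous n) (@far_cut0 n) ler01 cf).
  rewrite (HX s0 t0 cc FC); apply: eq_integral => w _; congr EFin.
  have Ow := OX w s0.
  by rewrite (cut_bep_semigroup sigma_gt0 HS HA (@far_cut_continuous n) (@far_cut0 n) ltr01 cf t0 Ow).
apply: (cvg_unique _ H1); first exact: ereal_hausdorff.
by apply: cvg_trans H2; apply: near_eq_cvg; apply: nearW => n; rewrite E.
Qed.

End transformed_process.

Theorem theorem3p4 (R : realType) (sigma k : R) (L : nat)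
    (hsigma : 0 < sigma) (hk : 0 <= k) (hL : (2 <= L)%N)
    (d : measure_display) (Omega : measurableType d) (P : probability Omega R)
    (X : R -> Omega -> 'rV[R]_L) (x : 'rV[R]_L) (hx : orthant x)
    (hX : is_ABEP sigma k P X x) :
  is_BEP k P (fun t w => gmap sigma (X t w)) (gmap sigma x).
Proof.
case: hX => mX OX cX X0 [S [HS HA HX]]; split.
- move=> t i t0.
  have := measurable_tmap (fun j => mX t j t0) i (@Wfun_continuous R sigma).
  by apply: eq_measurable_fun => w _; rewrite gmapE.
- by move=> t w t0; rewrite gmap_scaled; apply: scaled_gmap_orthant => //; exact: OX.
- move: cX; apply: filterS => w /subspace_continuousP cw.
  apply/subspace_continuousP => t t0; apply: (cvg_comp _ _ (cw t t0)).
  rewrite (_ : gmap sigma = scaled_gmap sigma 1); last by apply/funext => y; exact: gmap_scaled.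
  exact: scaled_gmap_continuous.
- by move: X0; apply: filterS => w ->.
- exists (bep_semigroup sigma S); split.
  + exact: bep_semigroup_feller HA.
  + exact: bep_generator_acts_on_core.
  + exact: markov_property_gmap HA HX.
Qed.
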